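(* Let $\alpha:\mathbb B^n\to\mathbb B^n$ be an analytic automorphism and let $T=(T_1,\dots,T_n)$ be a commuting multicontraction on a complex Hilbert space $\mathcal H$. Then: (i) $\alpha(T)$ is c.n.c. if and only if $T$ is c.n.c.; $\alpha(T)$ is of class $C_1$ if and only if $T$ is of class $C_1$; and $\alpha(T)$ is of class $C_0$ if and only if $T$ is of class $C_0$. (ii) The characteristic function $\theta_{\alpha(T)}$ coincides with $\theta_T\circ\alpha^{-1}$. (iii) If $T$ is a multishift, then $\alpha(T)$ is a multishift of the same multiplicity.
   Context: Fix an integer $n\ge1$; $\mathbb B^n$ is the open unit ball of $\mathbb C^n$, and $\langle z,w\rangle=\sum_i z_i\overline{w_i}$. $\mathcal H^n$ is the direct sum of $n$ copies of $\mathcal H$. A commuting multicontraction on $\mathcal H$ is an $n$-tuple $T=(T_1,\dots,T_n)$ of pairwise commuting bounded operators on $\mathcal H$ with $\sum_i T_iT_i^*\le 1_{\mathcal H}$. The same letter $T$ denotes the row contraction $T:\mathcal H^n\to\mathcal H$, $(h_1,\dots,h_n)\mapsto\sum_iT_ih_i$. For a contraction $C:\mathcal E_1\to\mathcal E_2$, $D_C=(1-C^*C)^{1/2}$ and $\mathcal D_C=\overline{D_C\mathcal E_1}$. For $z\in\mathbb B^n$ let $\mathbf z=(z_11_{\mathcal H}\ \cdots\ z_n1_{\mathcal H}):\mathcal H^n\to\mathcal H$. The characteristic function is $\theta_T:\mathbb B^n\to\mathcal L(\mathcal D_T,\mathcal D_{T^*})$, $\theta_T(z)=\big(-T+D_{T^*}(1_{\mathcal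 H}-\mathbf zT^* )^{-1}\mathbf zD_T\big)|_{\mathcal D_T}$. Two analytic functions $\Theta:\mathbb B^n\to\mathcal L(\mathcal E_1,\mathcal E_2)$, $\Theta':\mathbb B^n\to\mathcal L(\mathcal E_1',\mathcal E_2')$ coincide if there are unitaries $U_i:\mathcal E_i\to\mathcal E_i'$ with $U_2\Theta(z)=\Theta'(z)U_1$ for all $z\in\mathbb B^n$. Let $\rho_T(X)=\sum_iT_iXT_i^*$ on $\mathcal L(\mathcal H)$ and let $A_\infty(T)$ be the strong limit of the decreasing sequence of positive operators $\rho_T^k(1_{\mathcal H})$. $T$ is pure (or of class $C_0$) if $A_\infty(T)=0$; of class $C_1$ if $\ker A_\infty(T)=\{0\}$; completely noncoisometric (c.n.c.) if $\ker(1_{\mathcal H}-A_\infty(T))=\{0\}$. The Hardy--Arveson space $\mathbf H$ is the Hilbert space of analytic functions on $\mathbb B^n$ with reproducing kernel $k(z,w)=\frac1{1-\langle z,w\rangle}$; $\mathbf H(\mathcal E)=\mathbf H\otimes\mathcal E$ for a Hilbert space $\mathcal E$. The standard multishift on $\mathbf H(\mathcal E)$ is $S=(S_1,\dots,S_n)$, $S_if=z_if$. A tuple is a multishift of multiplicity $\dim\mathcal E$ if it is (simultaneously) unitarily equivalent to the standard multishift on $\mathbf H(\mathcal E)$. For $\lambda\in\mathbb B^n$, $\phi_\lambda(z)=\lambda-\frac{s_\lambda}{1-\langle z,\lambda\rangle}\big(z-(1-s_\lambda)P_\lambda z\big)$, where $s_\lambda=(1-|\lambda|^2)^{1/2}$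 and $P_\lambda$ is the orthogonal projection onto the span of $\lambda$. Every analytic automorphism of $\mathbb B^n$ has the form $\alpha=\omega\circ\phi_\lambda$ with $\lambda\in\mathbb B^n$ and $\omega$ a unitary map of $\mathbb C^n$; elements of $\mathbb C^n$ are regarded as $1\times n$ row matrices and $\omega$ acts as multiplication on the right by a unitary $n\times n$ matrix, $z\mapsto z\omega$. The tuple $\alpha(T)$ is defined by the analytic functional calculus; it is a commuting multicontraction. Explicitly, as row operators, $\phi_\lambda(T)=\boldsymbol\lambda-D_{\boldsymbol\lambda^*}(1_{\mathcal H}-T\boldsymbol\lambda^* )^{-1}TD_{\boldsymbol\lambda}$ with $\boldsymbol\lambda=(\lambda_11_{\mathcal H}\ \cdots\ \lambda_n1_{\mathcal H}):\mathcal H^n\to\mathcal H$, and $\alpha(T)=\phi_\lambda(T)(1_{\mathcal H}\otimes\omega)$. *)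

(* Defs.v *)
From HB Require Import structures.
From mathcomp Require Import all_boot all_order all_algebra.
From mathcomp Require Import complex.
From mathcomp Require Import boolp classical_sets functions reals.
From mathcomp Require Import topology normedtype sequences derive.

Set Implicit Arguments.
Unset Strict Implicit.
Unset Printing Implicit Defensive.

Import Order.TTheory GRing.Theory Num.Theory.
Import numFieldNormedType.Exports.

Local Open Scope classical_set_scope.
Local Open Scope ring_scope.

(* Scalars are C = R[i] for a realType R.  A Hilbert space is a complete
   normed C-module whose norm comes from an inner product; [inner] is linear
   in its first argument. *)
HB.mixin Record isHilbert (R : realType) H & CompleteNormedModule R[i] H := {
  inner : {dot H for Num.conj};
  inner_norm : forall x : H, inner x x = `|x| ^+ 2
}.

#[short(type="hilbertType")]
HB.structure Definition Hilbert (R : realType) :=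
  {H of CompleteNormedModule R[i] H & isHilbert R H}.

Section PreHilbert.
Variables (C : numClosedFieldType) (U : lmodType C) (form : {dot U for Num.conj}).
Local Notation "''[' u , v ]" := (form u v).

Lemma dot_CauchySchwarz (u v : U) : `|'[u, v]| ^+ 2 <= '[u, u] * '[v, v].
Proof.
have [->|v0] := eqVneq v 0.
  by rewrite (linear0r form u) (linear0r form 0) normr0 expr0n /= mulr0.
have vgt0 : 0 < '[v, v] by rewrite dnorm_gt0.
have rv : `|'[v, v]| ^+ 2 = '[v, v] ^+ 2 by rewrite ger0_norm// ltW.
have E : '['[v, v] *: u, '[u, v] *: v] = '[v, v] * (('[u, v])^* * '[u, v]).
  by rewrite (linearZr_LR form) /= (linearZl_LR form) /= mulrCA.
have := dnorm_ge0 form ('[v, v] *: u - '[u, v] *: v).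
rewrite dnormB !dnormZ rv E.
set a := '[v, v] in vgt0 rv E *; set b := '[u, v].
have aC : a^* = a by apply/CrealP; rewrite ger0_real ?ltW.
have -> : a * (b^* * b) = a * `|b| ^+ 2 by rewrite [_^* * _]mulrC -normCK.
have -> : (a * `|b| ^+ 2)^* = a * `|b| ^+ 2.
  apply/CrealP/ger0_real/mulr_ge0; [exact: ltW|exact: exprn_ge0].
rewrite [`|b| ^+ 2 * a]mulrC opprD addrA addrK expr2 -mulrA -mulrBr.
by rewrite pmulr_rge0// subr_ge0 mulrC.
Qed.

Lemma dot_triangle (u v : U) :
  sqrtC '[u + v, u + v] <= sqrtC '[u, u] + sqrtC '[v, v].
Proof.
have s0 w : 0 <= sqrtC '[w, w] by rewrite sqrtC_ge0 dnorm_ge0.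
rewrite -ler_sqr ?nnegrE ?addr_ge0// sqrtCK sqrrD !sqrtCK dnormD.
rewrite [leRHS]addrAC lerD2l.
set d := '[u, v].
have dle : `|d| <= sqrtC '[u, u] * sqrtC '[v, v].
  rewrite -ler_sqr ?nnegrE ?mulr_ge0// exprMn !sqrtCK.
  exact: dot_CauchySchwarz.
have rd : d + d^* \is Num.real by rewrite CrealE rmorphD /= conjCK addrC.
apply: (le_trans (real_ler_norm rd)); apply: (le_trans (ler_normD _ _)).
by rewrite norm_conjC mulr2n lerD.
Qed.

End PreHilbert.

(* The Hilbert direct sum of n copies of H, with the l2 norm. *)
Definition dsum (n : nat) (H : Type) : Type := {ffun 'I_n -> H}.

Section DirectSum.
Variables (R : realType) (H : hilbertType R) (n : nat).
Local Notation C := R[i].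
Local Notation Hn := (dsum n H).

HB.instance Definition _ := GRing.Lmodule.on Hn.

Definition dsum_inner (x y : Hn) : C := \sum_i inner (x i) (y i).

Fact dsum_inner_bilinear : bilinear_for *%R (Num.conj \; *%R) dsum_inner.
Proof.
split=> [u' a u v|u a v w] /=; rewrite /dsum_inner mulr_sumr -big_split /=;
    apply: eq_bigr => i _; rewrite !ffunE.
- by rewrite linearPl.
- by rewrite linearPr.
Qed.
HB.instance Definition _ :=
  bilinear_isBilinear.Build C Hn Hn C _ _ dsum_inner dsum_inner_bilinear.

Fact dsum_inner_hermitian (x y : Hn) :
  dsum_inner x y = (-1) ^+ false * (dsum_inner y x)^*.
Proof.
rewrite mul1r rmorph_sum; apply: eq_bigr => i _.
by rewrite hermC mul1r.
Qed.
HB.instance Definition _ :=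
  isHermitianSesquilinear.Build C Hn false Num.conj dsum_inner
    dsum_inner_hermitian.

Fact dsum_inner_gt0 (x : Hn) : x != 0 -> 0 < dsum_inner x x.
Proof.
move=> x0; have [i xi0] : exists i, x i != 0.
  apply/existsP; apply: contraNT x0; rewrite negb_exists => /forallP x0.
  by apply/eqP/ffunP => i; rewrite ffunE; apply/eqP; rewrite -[_ == _]negbK.
rewrite /dsum_inner (bigD1 i) //= ltr_pwDl ?dnorm_gt0//.
by apply: sumr_ge0 => j _; exact: dnorm_ge0.
Qed.
HB.instance Definition _ := isDotProduct.Build C Hn dsum_inner dsum_inner_gt0.

Definition dsum_norm (x : Hn) : C := sqrtC (dsum_inner x x).

Fact dsum_normD (x y : Hn) : dsum_norm (x + y) <= dsum_norm x + dsum_norm y.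
Proof. exact: dot_triangle. Qed.

Fact dsum_normZ (a : C) (x : Hn) : dsum_norm (a *: x) = `|a| * dsum_norm x.
Proof.
rewrite /dsum_norm (dnormZ dsum_inner).
by rewrite sqrtCM ?nnegrE ?exprn_ge0 ?(dnorm_ge0 dsum_inner)// sqrCK.
Qed.

Fact dsum_norm_eq0 (x : Hn) : dsum_norm x = 0 -> x = 0.
Proof. by move/eqP; rewrite sqrtC_eq0 (dnorm_eq0 dsum_inner) => /eqP. Qed.

HB.instance Definition _ :=
  Lmodule_isNormed.Build C Hn dsum_normD dsum_normZ dsum_norm_eq0.

Fact dsum_inner_norm (x : Hn) : dsum_inner x x = `|x| ^+ 2.
Proof. by rewrite [RHS]sqrtCK. Qed.

Fact dsum_norm_sqr (x : Hn) : `|x| ^+ 2 = \sum_i `|x i| ^+ 2.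
Proof.
by rewrite -dsum_inner_norm; apply: eq_bigr => i _; rewrite inner_norm.
Qed.

Fact dsum_norm_proj (x : Hn) i : `|x i| <= `|x|.
Proof.
rewrite -ler_sqr ?nnegrE// dsum_norm_sqr (bigD1 i) //= lerDl.
by apply: sumr_ge0 => j _; rewrite exprn_ge0.
Qed.

Fact dsum_norm_le (x : Hn) (e : C) :
  0 <= e -> (forall i, `|x i| <= e) -> `|x| <= n%:R * e.
Proof.
move=> e0 xe; have n0 : (n%:R : C) <= n%:R ^+ 2.
  by rewrite -natrX ler_nat; case: (n) => // m; rewrite leq_pmulr.
rewrite -ler_sqr ?nnegrE ?mulr_ge0// dsum_norm_sqr exprMn.
apply: (@le_trans _ _ (\sum_(i < n) e ^+ 2)).
  by apply: ler_sum => i _; rewrite ler_sqr ?nnegrE.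
by rewrite sumr_const card_ord -[leLHS]mulr_natl ler_wpM2r ?exprn_ge0.
Qed.

Fact dsum_complete (F : set_system Hn) : ProperFilter F -> cauchy F -> cvg F.
Proof.
move=> FF /cauchy_ballP Fc.
have Fi (i : 'I_n) : cvg ((fun x : Hn => x i) @ F).
  apply/cauchy_cvgP/cauchy_ballP => e e0.
  have [[/= A B] [/= FA FB] AB] := Fc _ e0.
  exists ((fun x : Hn => x i) @` A, (fun x : Hn => x i) @` B) => /=.
    by split; [apply: filterS FA|apply: filterS FB] => x ?; exists x.
  move=> [_ _] [/= [x Ax <-] [y By <-]].
  have := AB (x, y) (conj Ax By).
  rewrite -!ball_normE /= => /(le_lt_trans _); apply.
  by have := dsum_norm_proj (x - y) i; rewrite !ffunE.
pose l : Hn := [ffun i => lim ((fun x : Hn => x i) @ F)].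
apply/cvg_ex; exists l; apply/cvgrPdist_lt => e e0.
have n1 : 0 < (n.+1%:R : C) by rewrite ltr0n.
have d0 : 0 < e / n.+1%:R by rewrite divr_gt0.
have Fnear : F [set x : Hn | forall i, `|l i - x i| <= e / n.+1%:R].
  apply: filter_forall => i.
  have /cvgrPdist_le /(_ _ d0) := Fi i.
  by rewrite !near_simpl; apply: filterS => x /=; rewrite ffunE.
apply: filterS Fnear => x lx.
apply: le_lt_trans (@dsum_norm_le (l - x) _ (ltW d0) _) _.
  by move=> i; rewrite !ffunE; have := lx i; rewrite ffunE.
by rewrite mulrCA -[ltRHS]mulr1 ltr_pM2l// ltr_pdivrMr// mul1r ltr_nat.
Qed.
HB.instance Definition _ := Uniform_isComplete.Build Hn dsum_complete.

HB.instance Definition _ := isHilbert.Build R Hn dsum_inner_norm.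

End DirectSum.

(* Operators are plain functions between Hilbert spaces, with boundedness as a
   predicate.  The adjoint, the positive square root and the inverse are
   selected by [get]; each is unique when it exists. *)
Section Operators.
Variable R : realType.
Implicit Types H K : hilbertType R.

Definition bounded_operator H K (A : H -> K) : Prop :=
  linear A /\ continuous A.

Definition adjoint H K (A : H -> K) : K -> H :=
  get [set B : K -> H | forall x y, inner (A x) y = inner x (B y)].

Definition op_inv H (A : H -> H) : H -> H :=
  get [set B : H -> H | cancel A B /\ cancel B A].

Definition positive_operator H (A : H -> H) : Prop :=
  forall x, 0 <= inner (A x) x.

Definition op_le H (A B : H -> H) : Prop :=
  positive_operator (fun x => B x - A x).

Definition op_sqrt H (A : H -> H) : H -> H :=
  get [set B : H -> H |
    [/\ bounded_operator B, positive_operator B & forall x, B (B x) = A x]].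

Definition defect_op H K (A : H -> K) : H -> H :=
  op_sqrt (fun x => x - adjoint A (A x)).

Definition defect_space H K (A : H -> K) : set H :=
  closure (range (defect_op A)).

(* U restricts to a unitary from the closed subspace E of H onto the closed
   subspace F of K; the values of U outside E are irrelevant. *)
Definition unitary_on H K (E : set H) (F : set K) (U : H -> K) : Prop :=
  [/\ set_bij E F U,
      forall (a : R[i]) x y, E x -> E y -> U (a *: x + y) = a *: U x + U y &
      forall x y, E x -> E y -> inner (U x) (U y) = inner x y].

End Operators.

Section Ball.
Variables (R : realType) (n : nat).
Local Notation C := R[i].
Local Notation Cn := 'rV[R[i]]_n.
Implicit Types (z w lambda : Cn).

Definition cdot z w : C := \sum_i z ord0 i * (w ord0 i)^*.

Definition unit_ball : set Cn := [set z | cdot z z < 1].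

Definition analytic_on_ball (V : normedModType C) (f : Cn -> V) : Prop :=
  forall z : (Cn : normedModType C), unit_ball z -> differentiable f z.

Definition ball_inverse (alpha : Cn -> Cn) : Cn -> Cn :=
  'pinv_(fun=> 0) unit_ball alpha.

Definition ball_automorphism (alpha : Cn -> Cn) : Prop :=
  [/\ set_bij unit_ball unit_ball alpha, analytic_on_ball alpha &
      analytic_on_ball (ball_inverse alpha)].

Definition s_ lambda : C := sqrtC (1 - cdot lambda lambda).

(* For lambda = 0 the coefficient is 0 / 0 = 0, as it should be. *)
Definition proj_span lambda z : Cn :=
  (cdot z lambda / cdot lambda lambda) *: lambda.

Definition ball_involution lambda z : Cn :=
  lambda - (s_ lambda / (1 - cdot z lambda)) *:
             (z - (1 - s_ lambda) *: proj_span lambda z).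

End Ball.

Section Tuples.
Variables (R : realType) (n : nat) (H : hilbertType R).
Local Notation C := R[i].
Local Notation Cn := 'rV[R[i]]_n.
Local Notation Hn := (dsum n H).
Implicit Types (T : 'I_n -> H -> H) (z lambda : Cn) (omega : 'M[C]_n).

Definition row_op T : Hn -> H := fun h => \sum_i T i (h i).

Definition scalar_row z : Hn -> H := row_op (fun i x => z ord0 i *: x).

Definition dsum_inj (i : 'I_n) (x : H) : Hn :=
  [ffun j => if j == i then x else 0].

Definition row_entry (A : Hn -> H) : 'I_n -> H -> H :=
  fun i x => A (dsum_inj i x).

Definition rho T (X : H -> H) : H -> H :=
  fun x => \sum_i T i (X (adjoint (T i) x)).

Definition commuting_multicontraction T : Prop :=
  [/\ forall i, bounded_operator (T i),
      forall i j x, T i (T j x) = T j (T i x) &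
      op_le (rho T id) id].

Definition A_infty T : H -> H :=
  fun x => lim ((fun k => iter k (rho T) id x) @ \oo).

Definition class_C0 T : Prop := forall x, A_infty T x = 0.

Definition class_C1 T : Prop := forall x, A_infty T x = 0 -> x = 0.

Definition cnc T : Prop := forall x, x - A_infty T x = 0 -> x = 0.

Definition char_fun T z : Hn -> H := fun h =>
  - row_op T h
  + defect_op (adjoint (row_op T))
      (op_inv (fun x => x - scalar_row z (adjoint (row_op T) x))
         (scalar_row z (defect_op (row_op T) h))).

(* The row operator phi_lambda(T), by the explicit formula of the analytic
   functional calculus. *)
Definition involution_row lambda T : Hn -> H := fun h =>
  scalar_row lambda h
  - defect_op (adjoint (scalar_row lambda))
      (op_inv (fun x => x - row_op T (adjoint (scalar_row lambda) x))
         (row_op T (defect_op (scalar_row lambda) h))).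

(* 1 (x) omega : omega acts on row vectors from the right, so a row operator
   (A_1 ... A_n) composed with it has j-th entry \sum_i omega i j *: A_i. *)
Definition tensor_mx omega : Hn -> Hn := fun h =>
  [ffun i => \sum_j omega i j *: h j].

(* The tuple alpha(T) for the automorphism alpha z = phi_lambda(z) omega. *)
Definition aut_tuple lambda omega T : 'I_n -> H -> H :=
  row_entry (involution_row lambda T \o tensor_mx omega).

End Tuples.

(* Theta : B^n -> L(E1, E2) and Theta' : B^n -> L(F1, F2), where E1, E2, F1, F2
   are closed subspaces of the ambient Hilbert spaces; the first two conjuncts
   say that the values map E1 into E2 and F1 into F2. *)
Definition coincide (R : realType) (n : nat) (X1 X2 Y1 Y2 : hilbertType R)
    (E1 : set X1) (E2 : set X2) (Theta : 'rV[R[i]]_n -> X1 -> X2)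
    (F1 : set Y1) (F2 : set Y2) (Theta' : 'rV[R[i]]_n -> Y1 -> Y2) : Prop :=
  [/\ forall z, @unit_ball R n z -> {homo Theta z : x / E1 x >-> E2 x},
      forall z, @unit_ball R n z -> {homo Theta' z : x / F1 x >-> F2 x} &
      exists U1 U2, [/\ unitary_on E1 F1 U1, unitary_on E2 F2 U2 &
        forall z x, @unit_ball R n z -> E1 x ->
          U2 (Theta z x) = Theta' z (U1 x)]].

Section Multishift.
Variables (R : realType) (n : nat).
Local Notation C := R[i].
Local Notation Cn := 'rV[R[i]]_n.

(* F is the Hardy-Arveson space, its elements f being viewed as the functions
   ev f : the Hilbert space of analytic functions on the ball with reproducing
   kernel 1 / (1 - <z, w>). *)
Definition hardy_arveson (F : hilbertType R) (ev : F -> Cn -> C) : Prop :=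
  [/\ forall (a : C) f g z, unit_ball z ->
        ev (a *: f + g) z = a * ev f z + ev g z,
      forall f g, (forall z, unit_ball z -> ev f z = ev g z) -> f = g,
      forall f, analytic_on_ball (ev f : Cn -> C^o) &
      forall w, unit_ball w -> exists kw : F,
        (forall z, unit_ball z -> ev kw z = (1 - cdot z w)^-1) /\
        (forall f, inner f kw = ev f w)].

(* K is the Hilbert space tensor product of F and E, with t f e = f (x) e. *)
Definition hilbert_tensor (F E K : hilbertType R) (t : F -> E -> K) : Prop :=
  [/\ forall e, linear (t^~ e),
      forall f, linear (t f),
      forall f g e e', inner (t f e) (t g e') = inner f g * inner e e' &
      closure [set x | exists m (f : 'I_m -> F) (e : 'I_m -> E),
                         x = \sum_j t (f j) (e j)] = setT].

(* S_i (f (x) e) = (z_i f) (x) e, which determines the bounded operator S_i. *)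
Definition standard_multishift (F E K : hilbertType R) (ev : F -> Cn -> C)
    (t : F -> E -> K) (S : 'I_n -> K -> K) : Prop :=
  forall i, bounded_operator (S i) /\
    forall f, exists zf : F,
      (forall z, unit_ball z -> ev zf z = z ord0 i * ev f z) /\
      (forall e, S i (t f e) = t zf e).

(* T is a multishift of multiplicity dim E. *)
Definition multishift (E H : hilbertType R) (T : 'I_n -> H -> H) : Prop :=
  exists (F K : hilbertType R) (ev : F -> Cn -> C) (t : F -> E -> K)
         (S : 'I_n -> K -> K),
    [/\ hardy_arveson ev, hilbert_tensor t, standard_multishift ev t S &
        exists W : H -> K, unitary_on setT setT W /\
          forall i x, W (T i x) = S i (W x)].

End Multishift.

(* Main.v *)
(* Write L for the scalar row of lambda, s = (1 - |lambda|^2)^(1/2) and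
   G = (1 - T L^* )^-1. The defect operator of L is 1 - L^* L / (1 + s), so
   phi(T) = (L + s G L) / (1 + s) - s G T, and for every operator X
     X - rho_{phi(T)}(X) = s^2 G (X - rho_T(X)) G^*.
   Hence rho_T and rho_{alpha(T)} have the same fixed points. As A_infty(T) is
   the largest fixed point of rho_T below 1, A_infty(alpha(T)) = A_infty(T).

   For X = 1 the same identity, and its counterpart on H^n, show that
   D_{T^*} s G^* x and -D_T (1 - L^* T)^-1 D_L h are isometric images of
   D_{phi(T)^*} x and D_{phi(T)} h. These isometries extend to the unitaries of
   the coincidence, because theta_T(z) D_T h = D_{T^*} y, where y solves
   (1 - z T^* ) y = (z - T) h.

   A multishift stays one on the same Hilbert space: only the evaluations of its
   functions change, by a weighted composition with alpha^-1. *)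

Require Import Defs.
From HB Require Import structures.
From mathcomp Require Import all_boot all_order all_algebra.
From mathcomp Require Import complex.
From mathcomp Require Import boolp classical_sets functions reals.
From mathcomp Require Import topology normedtype sequences derive.
From mathcomp Require Import ring lra.

Set Implicit Arguments.
Unset Strict Implicit.
Unset Printing Implicit Defensive.

Import Order.TTheory GRing.Theory Num.Theory.
Import numFieldNormedType.Exports.

Local Open Scope classical_set_scope.
Local Open Scope ring_scope.

(** * Norms and convergence *)

Section Norm.
Variables (R : realType) (V : normedZmodType R[i]).
Implicit Types (x y : V).

(** The identity is needed for every X, since X = 1 only controls the defect operators while A_infty
    involves all fixed points. G^* is invertible, so the identity can be read both ways, and T never
    has to be recovered as a Moebius transform of alpha(T).

    Adjoint, inverse and square root are values of [get] and say nothing until existence and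
    uniqueness are proved; hence the Riesz representation, Neumann series and monotone iteration.
    Once the roots exist, <D_C x, D_C y> = <x, y> - <C x, C y> removes them from the computations
    with inner products.

    For the multishift, T_j multiplies functions of a by a_j, so G multiplies by 1 / (1 - <a,
    lambda>) and alpha(T)_j by the j-th coordinate of alpha(a). Reading f at a = alpha^-1(z) turns
    this into multiplication by z_j; the weight is what keeps the kernel equal to 1 / (1 - <z, w>).
    The shift is only described on elementary tensors, so operators on the function space are
    bounded through a fixed nonzero vector of E, and E = 0 is treated apart. *)

Definition rnorm x : R := complex.Re `|x|.

(** Norms over [R[i]] are themselves elements of [R[i]], whose order is partial. [rnorm] is the same
    number in [R], where [lra], squeezing and monotone convergence apply. *)
Lemma normE x : `|x| = (rnorm x)%:C%C.
Proof. by rewrite /rnorm RRe_real// ger0_real. Qed.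

Lemma rnorm_ge0 x : 0 <= rnorm x.
Proof. by rewrite -lecR -normE; exact: normr_ge0. Qed.

Lemma rnorm_eq0 x : (rnorm x == 0) = (x == 0).
Proof.
by rewrite -[RHS]normr_eq0 normE -[0 in RHS]/(0%:C)%C (inj_eq (@complexI R)).
Qed.

Lemma rnorm0 : rnorm (0 : V) = 0.
Proof. by apply/eqP; rewrite rnorm_eq0. Qed.

Lemma rnormN x : rnorm (- x) = rnorm x.
Proof. by rewrite /rnorm normrN. Qed.

Lemma rdistC x y : rnorm (x - y) = rnorm (y - x).
Proof. by rewrite -rnormN opprB. Qed.

Lemma ler_rnormD x y : rnorm (x + y) <= rnorm x + rnorm y.
Proof. by rewrite -lecR rmorphD/= -!normE ler_normD. Qed.

Lemma ler_rdistD z x y : rnorm (x - y) <= rnorm (x - z) + rnorm (z - y).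
Proof. by rewrite (le_trans _ (ler_rnormD _ _))// addrA subrK. Qed.

End Norm.

Section NormConvergence.
Variables (R : realType) (V : normedModType R[i]).
Implicit Types (x y : V).

Lemma cvg_rnormP (u : nat -> V) x :
  u @ \oo --> x <-> rnorm (u k - x) @[k --> \oo] --> (0 : R).
Proof.
split=> [/cvgrPdist_lt ux|/cvgrPdist_lt ux].
- apply/cvgr0Pnorm_lt => e e0.
  have e0' : 0 < e%:C%C by rewrite ltcR.
  have := ux _ e0'; apply: filterS => k.
  by rewrite normE ltcR rdistC ger0_norm// rnorm_ge0.
- apply/cvgrPdist_lt => e e0.
  have eE : e = (complex.Re e)%:C%C by rewrite RRe_real// gtr0_real.
  have e0' : 0 < complex.Re e by rewrite -ltcR -eE.
  have := ux _ e0'; apply: filterS => k.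
  by rewrite sub0r normrN ger0_norm ?rnorm_ge0// eE normE ltcR rdistC.
Qed.

Lemma cvg_rnorm_lt (u : nat -> V) x (e : R) :
  0 < e -> u @ \oo --> x -> exists k, rnorm (u k - x) < e.
Proof.
move=> e0 /cvg_rnormP/cvgr0Pnorm_lt/(_ _ e0) [N _ /(_ N (leqnn N))] /=.
by rewrite ger0_norm ?rnorm_ge0 //; exists N.
Qed.

Lemma cvg_rnorm_le (u : nat -> V) x (a : nat -> R) :
  (forall k, rnorm (u k - x) <= a k) -> a @ \oo --> (0 : R) -> u @ \oo --> x.
Proof.
move=> ua a0; apply/cvg_rnormP.
apply: (@squeeze_cvgr _ _ _ _ (fun=> 0) a) => //; last exact: cvg_cst.
by apply: nearW => k; rewrite rnorm_ge0 ua.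
Qed.

Lemma closure_rnormP (A : set V) x :
  closure A x <-> forall e : R, 0 < e -> exists2 y, A y & rnorm (x - y) < e.
Proof.
split=> [Ax e e0|Ax B /nbhs_ballP [e /= e0 eB]].
  have e0' : 0 < e%:C%C by rewrite ltcR.
  have [y [Ay]] := Ax _ (nbhsx_ballx x _ e0').
  by rewrite -ball_normE /= normE ltcR; exists y.
have eE : e = (complex.Re e)%:C%C by rewrite RRe_real// gtr0_real.
have [y Ay xy] := Ax (complex.Re e) ltac:(by rewrite -ltcR -eE).
exists y; split=> //; apply: eB.
by rewrite -ball_normE /= normE eE ltcR.
Qed.

Lemma invS_cvg0 : (k.+1%:R^-1 : R) @[k --> \oo] --> (0 : R).
Proof. by have := @cvg_harmonic R; rewrite /harmonic. Qed.

Lemma closure_seqP (A : set V) x :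
  closure A x <-> exists2 u : nat -> V, (forall k, A (u k)) & u @ \oo --> x.
Proof.
rewrite closure_rnormP; split=> [Ax|[u Au ux] e e0].
  have {Ax}/choice [u ux] : forall k, exists y, A y /\ rnorm (x - y) < k.+1%:R^-1.
    by move=> k; have [|y Ay xy] := Ax k.+1%:R^-1; [rewrite invr_gt0|exists y].
  exists u => [k|]; first by case: (ux k).
  apply: (cvg_rnorm_le _ invS_cvg0) => k.
  by rewrite rdistC ltW//; case: (ux k).
by have [k] := cvg_rnorm_lt e0 ux; rewrite rdistC; exists (u k).
Qed.

Lemma seq_cvg_unique (u : nat -> V) x y :
  u @ \oo --> x -> u @ \oo --> y -> x = y.
Proof. by move=> ux uy; exact: (cvg_unique (@norm_hausdorff _ V) ux uy). Qed.

Lemma seq_cvg_sum (I : Type) (r : seq I) (F : I -> nat -> V) (l : I -> V) :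
  (forall i, F i @ \oo --> l i) ->
  (\sum_(i <- r) F i k) @[k --> \oo] --> \sum_(i <- r) l i.
Proof.
move=> Fl; elim: r => [|i r IH].
  by rewrite big_nil; under eq_cvg do rewrite big_nil; exact: cvg_cst.
rewrite big_cons; under eq_cvg do rewrite big_cons.
exact: cvgD.
Qed.

End NormConvergence.

Lemma rnormZ (R : realType) (V : normedModType R[i]) (a : R[i]) (x : V) :
  rnorm (a *: x) = rnorm a * rnorm x.
Proof. by apply: (@complexI R); rewrite rmorphM/= -!normE normrZ. Qed.

Lemma rnormM (R : realType) (a b : R[i]) : rnorm (a * b) = rnorm a * rnorm b.
Proof. by apply: (@complexI R); rewrite rmorphM/= -!normE normrM. Qed.

Lemma rnorm_real (R : realType) (a : R) : 0 <= a -> rnorm (a%:C%C : R[i]) = a.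
Proof. by move=> a0; apply: (@complexI R); rewrite -normE ger0_norm ?lecR. Qed.

Lemma Re_le_rnorm (R : realType) (a : R[i]) : complex.Re a <= rnorm a.
Proof.
rewrite -lecR -normE (le_trans _ (normc_ge_Re a))//.
by rewrite lecR ler_norm.
Qed.

Lemma cauchy_rnorm_cvg (R : realType) (V : completeNormedModType R[i])
    (u : nat -> V) :
  (forall e : R, 0 < e -> exists N, forall k l, (N <= k)%N -> (N <= l)%N ->
    rnorm (u k - u l) < e) -> cvg (u @ \oo).
Proof.
move=> uC; apply/cauchy_cvgP/cauchy_ballP => e e0.
have eE : e = (complex.Re e)%:C%C by rewrite RRe_real// gtr0_real.
have [|N uN] := uC (complex.Re e); first by rewrite -ltcR -eE.
exists (u @` [set k | (N <= k)%N], u @` [set k | (N <= k)%N]) => /=.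
  by split; exists N => // k /= Nk; exists k.
by move=> [_ _] [/= [k Nk <-] [l Nl <-]]; rewrite -ball_normE /= normE eE ltcR uN.
Qed.

(** Serves twice: with exponent 1 and a geometric tail [q] for the Neumann series, with exponent 2
    and the quadratic form [q] of a decreasing sequence of operators. *)
Lemma expr_rnorm_cauchy_cvg (R : realType) (V : completeNormedModType R[i])
    (p : nat) (u : nat -> V) (q : nat -> R) :
  cvgn q -> (forall k l, (k <= l)%N -> rnorm (u k - u l) ^+ p.+1 <= `|q k - q l|) ->
  cvg (u @ \oo).
Proof.
move=> /cauchy_cvgP /cauchy_ballP qC uq; apply: cauchy_rnorm_cvg => e e0.
have [|[A B] /= [[N1 _ A1] [N2 _ B2]] AB] := qC (e ^+ p.+1); first by rewrite exprn_gt0.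
suff H k l : (maxn N1 N2 <= k)%N -> (maxn N1 N2 <= l)%N -> (k <= l)%N ->
    rnorm (u k - u l) < e.
  exists (maxn N1 N2) => k l Nk Nl; have [kl|/ltnW lk] := leqP k l.
    exact: H.
  by rewrite rdistC; exact: H.
move=> Nk Nl kl; rewrite -(@ltr_pXn2r _ p.+1) ?nnegrE ?rnorm_ge0 ?(ltW e0)//.
rewrite (le_lt_trans (uq _ _ kl))//.
have := AB (q k, q l); rewrite /= -ball_normE /=; apply; split.
  by apply: A1 => /=; rewrite (leq_trans _ Nk)// leq_maxl.
by apply: B2 => /=; rewrite (leq_trans _ Nl)// leq_maxr.
Qed.

(** * Inner products and bounded operators *)

Section InnerProduct.
Variables (R : realType) (H : hilbertType R).
Implicit Types (x y z : H) (a : R[i]).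

Lemma innerDl x y z : inner (x + y) z = inner x z + inner y z.
Proof. exact: linearDl. Qed.

Lemma innerNl x z : inner (- x) z = - inner x z.
Proof. exact: linearNl. Qed.

Lemma innerZl a x z : inner (a *: x) z = a * inner x z.
Proof. exact: linearZl_LR. Qed.

Lemma innerDr x y z : inner x (y + z) = inner x y + inner x z.
Proof. exact: linearDr. Qed.

Lemma innerNr x z : inner x (- z) = - inner x z.
Proof. exact: linearNr. Qed.

Lemma innerZr a x z : inner x (a *: z) = a^* * inner x z.
Proof. exact: linearZr_LR. Qed.

Definition innerE :=
  (innerDl, innerNl, innerZl, innerDr, innerNr, innerZr).

Lemma inner0l z : inner 0 z = 0.
Proof. exact: linear0l. Qed.

Lemma inner0r x : inner x 0 = 0.
Proof. exact: linear0r. Qed.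

Lemma inner_suml I (r : seq I) (P : pred I) (F : I -> H) z :
  inner (\sum_(i <- r | P i) F i) z = \sum_(i <- r | P i) inner (F i) z.
Proof. exact: linear_sumlz. Qed.

Lemma inner_sumr I (r : seq I) (P : pred I) (F : I -> H) x :
  inner x (\sum_(i <- r | P i) F i) = \sum_(i <- r | P i) inner x (F i).
Proof. exact: linear_sumr. Qed.

Lemma innerC x y : inner x y = (inner y x)^*.
Proof. by rewrite hermC mul1r. Qed.

Lemma innerxx x : inner x x = (rnorm x ^+ 2)%:C%C.
Proof. by rewrite inner_norm normE rmorphXn. Qed.

Lemma inner_eqP x y : (forall z, inner x z = inner y z) -> x = y.
Proof.
move=> xy; apply/eqP; rewrite -subr_eq0 -normr_eq0 -sqrf_eq0.
by rewrite -inner_norm innerDl innerNl xy subrr.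
Qed.

Lemma inner_eqPr x y : (forall z, inner z x = inner z y) -> x = y.
Proof.
by move=> xy; apply: inner_eqP => z; rewrite innerC xy -innerC.
Qed.

Lemma ler_rnorm_inner x y : rnorm (inner x y) <= rnorm x * rnorm y.
Proof.
rewrite -(@ler_pXn2r _ 2) ?nnegrE ?mulr_ge0 ?rnorm_ge0// -lecR.
rewrite !rmorphXn/= -normE (le_trans (dot_CauchySchwarz inner x y))//.
by rewrite !innerxx -rmorphM -rmorphXn exprMn.
Qed.

Lemma cvg_inner (u v : nat -> H) x y : u @ \oo --> x -> v @ \oo --> y ->
  inner (u k) (v k) @[k --> \oo] --> (inner x y : R[i]^o).
Proof.
move=> /cvg_rnormP ux /cvg_rnormP vy.
apply: (@cvg_rnorm_le _ _ _ _ (fun k =>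
  rnorm (u k - x) * rnorm (v k - y) + rnorm (u k - x) * rnorm y +
  rnorm x * rnorm (v k - y))).
  move=> k; have -> : (inner (u k) (v k) - inner x y) =
      inner (u k - x) (v k - y) + inner (u k - x) y + inner x (v k - y).
    by rewrite !innerE; ring.
  rewrite (le_trans (ler_rnormD _ _))// lerD ?ler_rnorm_inner//.
  by rewrite (le_trans (ler_rnormD _ _))// lerD ?ler_rnorm_inner.
rewrite (_ : 0 = 0 * 0 + 0 * rnorm y + rnorm x * 0 :> R); last by ring.
by apply: cvgD; [apply: cvgD|]; apply: cvgM => //; exact: cvg_cst.
Qed.

End InnerProduct.

Section BoundedOperators.
Variable R : realType.
Implicit Types H K : hilbertType R.

Lemma bounded_operatorP H K (A : H -> K) :
  bounded_operator A <->
  linear A /\ exists M : R, 0 <= M /\ forall x, rnorm (A x) <= M * rnorm x.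
Proof.
split=> [[linA contA]|[linA [M [M0 AM]]]]; split=> //.
  pose LA := GRing.isLinear.Build _ _ _ _ A linA.
  pose A' : {linear H -> K} := HB.pack A LA.
  have : bounded_near A' (nbhs (0 : H)) by apply/linear_bounded_continuous.
  move=> /linear_boundedP [y [yr Hy]].
  have yE : y = (complex.Re y)%:C%C by rewrite RRe_real.
  exists (`|complex.Re y| + 1); split; first by rewrite addr_ge0.
  move=> x; rewrite -lecR rmorphM/= -!normE; apply: Hy.
  by rewrite yE ltcR ltr_pwDr// ler_norm.
move=> x; apply/cvgrPdist_le => e e0.
(* [M] may be 0, so the radius is divided by [M + 1]. *)
have M1 : 0 < (M + 1)%:C%C :> R[i] by rewrite ltcR; lra.
have d0 : 0 < e / (M + 1)%:C%C by rewrite divr_gt0.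
near=> y.
have -> : A x - A y = A (x - y).
  by rewrite (_ : x - y = -1 *: y + x) ?linA ?scaleN1r addrC.
rewrite normE (@le_trans _ _ (M%:C%C * `|x - y|))//.
  by rewrite !normE -rmorphM/= lecR.
rewrite (@le_trans _ _ ((M + 1)%:C%C * `|x - y|))//.
  by rewrite ler_wpM2r// lecR; lra.
rewrite mulrC -ler_pdivlMr//.
Unshelve. all: by end_near. Qed.

Section Linear.
Variables (H K : hilbertType R) (A : H -> K).
Hypothesis bA : bounded_operator A.

Lemma bopP (a : R[i]) x y : A (a *: x + y) = a *: A x + A y.
Proof. by case: bA => linA _; rewrite linA. Qed.

Lemma bopD x y : A (x + y) = A x + A y.
Proof. by rewrite -[x in LHS]scale1r bopP scale1r. Qed.

Lemma bop0 : A 0 = 0.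
Proof. by apply: (addrI (A 0)); rewrite -bopD !addr0. Qed.

Lemma bopZ (a : R[i]) x : A (a *: x) = a *: A x.
Proof. by rewrite -[a *: x]addr0 bopP bop0 addr0. Qed.

Lemma bopN x : A (- x) = - A x.
Proof. by rewrite -scaleN1r bopZ scaleN1r. Qed.

Lemma bop_sum I (r : seq I) (P : pred I) (F : I -> H) :
  A (\sum_(i <- r | P i) F i) = \sum_(i <- r | P i) A (F i).
Proof. exact: (big_morph A bopD bop0). Qed.

Lemma bop_cvg (u : nat -> H) x : u @ \oo --> x -> A (u k) @[k --> \oo] --> A x.
Proof. by case: bA => _ cA ux; apply: continuous_cvg => //; exact: cA. Qed.

Lemma bop_bound : exists M : R, 0 <= M /\ forall x, rnorm (A x) <= M * rnorm x.
Proof. by case/bounded_operatorP: bA. Qed.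

End Linear.

Lemma bounded_comp H K (L : hilbertType R) (B : K -> L) (A : H -> K) :
  bounded_operator B -> bounded_operator A -> bounded_operator (fun x => B (A x)).
Proof.
move=> bB bA; apply/bounded_operatorP; split=> [a x y|].
  by rewrite !(bopP bA, bopP bB).
have [M [M0 AM]] := bop_bound bA; have [N [N0 BN]] := bop_bound bB.
exists (N * M); split=> [|x]; first exact: mulr_ge0.
by rewrite (le_trans (BN _))// -mulrA ler_wpM2l.
Qed.

Lemma bounded_add H K (A B : H -> K) :
  bounded_operator A -> bounded_operator B -> bounded_operator (fun x => A x + B x).
Proof.
move=> bA bB; apply/bounded_operatorP; split=> [a x y|].
  by rewrite !(bopP bA, bopP bB) scalerDr addrACA.
have [M [M0 AM]] := bop_bound bA; have [N [N0 BN]] := bop_bound bB.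
exists (M + N); split=> [|x]; first exact: addr_ge0.
by rewrite (le_trans (ler_rnormD _ _))// mulrDl lerD.
Qed.

Lemma bounded_scale H K (c : R[i]) (A : H -> K) :
  bounded_operator A -> bounded_operator (fun x => c *: A x).
Proof.
move=> bA; apply/bounded_operatorP; split=> [a x y|].
  by rewrite (bopP bA) scalerDr !scalerA mulrC.
have [M [M0 AM]] := bop_bound bA.
exists (rnorm c * M); split=> [|x]; first by rewrite mulr_ge0// rnorm_ge0.
by rewrite rnormZ -mulrA ler_wpM2l// rnorm_ge0.
Qed.

Lemma bounded_id H : bounded_operator (fun x : H => x).
Proof.
apply/bounded_operatorP; split=> //; exists 1; split=> // x.
by rewrite mul1r.
Qed.

Lemma bounded_zero H K : bounded_operator (fun _ : H => 0 : K).
Proof.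
apply/bounded_operatorP; split=> [a x y|]; first by rewrite scaler0 addr0.
by exists 0; split=> // x; rewrite mul0r rnorm0.
Qed.

Lemma bounded_opp H K (A : H -> K) :
  bounded_operator A -> bounded_operator (fun x => - A x).
Proof.
move=> /(bounded_scale (-1)).
by rewrite (_ : (fun _ => _) = fun x => - A x)//; apply/funext => x; rewrite scaleN1r.
Qed.

Lemma bounded_sub H K (A B : H -> K) :
  bounded_operator A -> bounded_operator B -> bounded_operator (fun x => A x - B x).
Proof. by move=> bA bB; exact: bounded_add bA (bounded_opp bB). Qed.

Lemma bounded_sum H K (I : Type) (r : seq I) (A : I -> H -> K) :
  (forall i, bounded_operator (A i)) ->
  bounded_operator (fun x => \sum_(i <- r) A i x).
Proof.
move=> bA; elim: r => [|i r IH].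
  rewrite (_ : (fun _ => _) = fun _ : H => 0 : K); first exact: bounded_zero.
  by apply/funext => x; rewrite big_nil.
rewrite (_ : (fun _ => _) = fun x => A i x + \sum_(j <- r) A j x).
  exact: bounded_add.
by apply/funext => x; rewrite big_cons.
Qed.

End BoundedOperators.

(** * Riesz representation, adjoints, Neumann inverses *)

Section ComplexParts.
Variable R : realType.
Implicit Types a b : R[i].

Lemma ReD a b : complex.Re (a + b) = complex.Re a + complex.Re b.
Proof. by case: a b => ? ? []. Qed.

Lemma ReN a : complex.Re (- a) = - complex.Re a.
Proof. by case: a. Qed.

Lemma ReC a : complex.Re (a^*) = complex.Re a.
Proof. by case: a. Qed.

Lemma ReZ (r : R) a : complex.Re (r%:C%C * a) = r * complex.Re a.
Proof. by case: a => ? ? /=; rewrite mul0r subr0. Qed.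

Lemma conj_real (r : R) : (r%:C%C)^* = r%:C%C.
Proof. by apply/eqP; rewrite eq_complex /= oppr0 !eqxx. Qed.

Lemma mulC_conj a : a * a^* = (rnorm a ^+ 2)%:C%C.
Proof. by rewrite -normCK normE rmorphXn. Qed.

Lemma conjM a b : (a * b)^* = a^* * b^*. Proof. exact: rmorphM. Qed.
Lemma conjD a b : (a + b)^* = a^* + b^*. Proof. exact: rmorphD. Qed.
Lemma conjN a : (- a)^* = - a^*. Proof. exact: rmorphN. Qed.
Lemma conjV a : a^-1^* = (a^*)^-1. Proof. exact: fmorphV. Qed.
Lemma conj1 : 1^* = 1 :> R[i]. Proof. exact: rmorph1. Qed.
Definition conjE := (conjM, conjD, conjN, conjV, conj1).

(** Vanishing of the first variation at a minimum. The choice t = - b^* / (c + 1) makes the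
    expression a negative multiple of |b|^2; the denominator c + 1 allows c = 0. *)
Lemma quad_cross (c : R) b : 0 <= c ->
  (forall t : R[i], 0 <= rnorm t ^+ 2 * c + 2 * complex.Re (t * b)) -> b = 0.
Proof.
move=> c0 H; pose e := (c + 1)^-1.
have e0 : 0 < e by rewrite invr_gt0; lra.
have ec : e * c = 1 - e by rewrite /e; field; apply: lt0r_neq0; lra.
have := H (- (e%:C%C * b^*)).
rewrite rnormN rnormM (rnorm_real (ltW e0)) mulNr ReN -(mulrA e%:C%C) ReZ.
have -> : rnorm b^* = rnorm b.
  by apply: (@complexI R); rewrite -!normE norm_conjC.
rewrite [_^* * _]mulrC mulC_conj /= => h.
apply/eqP; rewrite -rnorm_eq0 -sqrf_eq0 eq_le exprn_ge0 ?rnorm_ge0// andbT.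
have : 0 <= e * rnorm b ^+ 2 * (e * c - 2).
  by rewrite (le_trans h)// le_eqVlt; apply/orP; left; apply/eqP; ring.
rewrite ec nmulr_lge0; last lra.
by rewrite pmulr_rle0.
Qed.

End ComplexParts.

Section HilbertSpace.
Variables (R : realType) (H : hilbertType R).
Implicit Types x y z : H.

Lemma sqr_rnorm x : rnorm x ^+ 2 = complex.Re (inner x x).
Proof. by rewrite innerxx. Qed.

Lemma sqr_rnormD x y :
  rnorm (x + y) ^+ 2 = rnorm x ^+ 2 + rnorm y ^+ 2 + 2 * complex.Re (inner y x).
Proof.
by rewrite !sqr_rnorm !innerE !ReD (innerC x y) ReC; ring.
Qed.

Lemma cvg_Re (u : nat -> R[i]^o) (a : R[i]) :
  u @ \oo --> (a : R[i]^o) -> complex.Re (u k) @[k --> \oo] --> complex.Re a.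
Proof.
move=> /cvg_rnormP ua; apply/subr_cvg0/norm_cvg0P.
apply: (@squeeze_cvgr _ _ _ _ (fun=> 0) _ _ _ _ _ ua); last exact: cvg_cst.
apply: nearW => k; rewrite normr_ge0 /= -ReN -ReD ler_norml Re_le_rnorm andbT.
by rewrite lerNl -ReN -[leRHS](@rnormN _ R[i]^o) Re_le_rnorm.
Qed.

(* The representing vector minimizes [|x|^2 - 2 Re (f x)]; minimizing sequences
   are Cauchy by the parallelogram law. *)
Lemma riesz (f : H -> R[i]) (M : R) :
    (forall (a : R[i]) x y, f (a *: x + y) = a * f x + f y) ->
    (forall x, rnorm (f x) <= M * rnorm x) ->
  exists y, forall x, f x = inner x y.
Proof.
move=> flin fM; pose J x := rnorm x ^+ 2 - 2 * complex.Re (f x).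
have fD x y : f (x + y) = f x + f y by rewrite -[x in LHS]scale1r flin mul1r.
have f0 : f 0 = 0 by apply: (addrI (f 0)); rewrite -fD !addr0.
have fZ a x : f (a *: x) = a * f x by rewrite -[_ *: _]addr0 flin f0 addr0.
have JD x h : J (x + h) = J x + rnorm h ^+ 2 + 2 * complex.Re (inner h x - f h).
  by rewrite /J sqr_rnormD fD !ReD ReN; ring.
have lbJ : has_lbound (range J).
  exists (- M ^+ 2) => _ [x _ <-].
  have := le_trans (Re_le_rnorm (f x)) (fM x).
  have := sqr_ge0 (rnorm x - M); rewrite /J sqrrB; lra.
have infJ : has_inf (range J) by split=> //; exists (J 0), 0.
set d := inf (range J).
have dJ x : d <= J x by apply: ge_inf => //; exists x.
have /choice [u Ju] : forall k, exists x, J x < d + k.+1%:R^-1.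
  by move=> k; have [|_ [x _ <-] Jx] := @inf_adherent _ _ k.+1%:R^-1 _ infJ;
    [rewrite invr_gt0|exists x].
have inv_le (N k : nat) : (N <= k)%N -> k.+1%:R^-1 <= N.+1%:R^-1 :> R.
  by move=> Nk; rewrite lef_pV2 ?posrE// ler_nat.
have [x0 ux0] : exists x0, u @ \oo --> x0.
  apply/cvg_ex; apply: cauchy_rnorm_cvg => e e0.
  have /cvgr0Pnorm_lt /(_ (e ^+ 2 / 4)) [|N _ /(_ N (leqnn N))] := @invS_cvg0 R.
    by rewrite divr_gt0// exprn_gt0.
  rewrite /= ger0_norm ?invr_ge0// => HN; exists N => k l Nk Nl.
  rewrite -(@ltr_pXn2r _ 2) ?nnegrE ?rnorm_ge0 ?(ltW e0)//.
  (* u k and u l are m plus and minus half their difference, so the cross terms of [e1] and [e2]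
     cancel in the sum. With d <= J m this puts |u k - u l|^2 / 2 below 2 / (N + 1). *)
  pose m := 2^-1 *: (u k + u l).
  have e1 : J (u k) = J m + rnorm (2^-1 *: (u k - u l)) ^+ 2 +
      2 * complex.Re (inner (2^-1 *: (u k - u l)) m - f (2^-1 *: (u k - u l))).
    by rewrite -JD; congr J; apply: inner_eqP => z; rewrite /m !innerE; field.
  have e2 : J (u l) = J m + rnorm (2^-1 *: (u k - u l)) ^+ 2 -
      2 * complex.Re (inner (2^-1 *: (u k - u l)) m - f (2^-1 *: (u k - u l))).
    rewrite -[rnorm _ in RHS]rnormN -mulrN -ReN opprD -innerNl.
    rewrite -[- f _]mulN1r -fZ scaleN1r -JD; congr J.
    by apply: inner_eqP => z; rewrite /m !innerE; field.
  have := dJ m; have := Ju k; have := Ju l.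
  have := inv_le _ _ Nk; have := inv_le _ _ Nl.
  have : rnorm (2^-1 *: (u k - u l)) ^+ 2 = rnorm (u k - u l) ^+ 2 / 4.
    rewrite rnormZ (_ : 2^-1 = (2^-1)%:C%C); last by rewrite fmorphV rmorph_nat.
    by rewrite rnorm_real ?invr_ge0// exprMn; field.
  move: e1 e2 HN; rewrite -/m.
  move: (J (u k)) (J (u l)) (J m) (complex.Re _) => a b c g.
  move: (rnorm _ ^+ 2) (rnorm _ ^+ 2) => p q.
  move: (N.+1%:R^-1) (k.+1%:R^-1) (l.+1%:R^-1) => iN ik il.
  lra.
have Jx0 : J x0 <= d.
  pose r k := rnorm (u k - x0).
  have r0 : r k @[k --> \oo] --> 0 by apply/cvg_rnormP.
  (* Expanding [J] at u k and using |u k| <= r k + |x0| bounds J x0 - d by [w k]; the 3 collects one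
     r^2 from the square and two from the inner product. *)
  pose w k := k.+1%:R^-1 + 3 * (r k * r k) + 2 * r k * (rnorm x0 + M).
  rewrite -subr_le0; apply: (@cvgr_to_ge _ \oo _ _ w).
    rewrite (_ : 0 = 0 + 3 * (0 * 0) + 2 * 0 * (rnorm x0 + M) :> R); last by ring.
    apply: cvgD; [apply: cvgD|]; first exact: invS_cvg0.
      by apply: cvgM; [exact: cvg_cst|apply: cvgM].
    by apply: cvgM; [apply: cvgM => //|]; exact: cvg_cst.
  have x0E k : x0 = u k + (x0 - u k) by rewrite addrC subrK.
  apply: nearW => k; rewrite [in J x0](x0E k) JD /w.
  have := Ju k; rewrite -/(r k) rdistC -/(r k) ReD ReN.
  have := le_trans (Re_le_rnorm _) (ler_rnorm_inner (x0 - u k) (u k)).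
  have := le_trans (Re_le_rnorm _) (fM (- (x0 - u k))).
  rewrite rnormN rdistC -/(r k) -scaleN1r fZ mulN1r ReN.
  have : rnorm (u k) <= r k + rnorm x0.
    by rewrite -[u k in leLHS](subrK x0) ler_rnormD.
  have := rnorm_ge0 (u k - x0); rewrite -/(r k).
  set a := rnorm (u k); set b := rnorm x0; set c := r k.
  set p := complex.Re _; set q := complex.Re _ => c0 ab.
  have : c * a <= c * (c + b) by rewrite ler_wpM2l.
  by rewrite expr2; move: (k.+1%:R^-1) => ik; lra.
exists x0 => h; apply/esym/eqP; rewrite -subr_eq0; apply/eqP.
apply: (@quad_cross _ (rnorm h ^+ 2)); first by rewrite exprn_ge0// rnorm_ge0.
move=> t; have := le_trans Jx0 (dJ (x0 + t *: h)).
by rewrite JD innerZl fZ rnormZ exprMn -mulrBr -addrA lerDl.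
Qed.

End HilbertSpace.

Section Adjoint.
Variables (R : realType) (H K : hilbertType R).

Lemma adjoint_exists (A : H -> K) : bounded_operator A ->
  exists B : K -> H, forall x y, inner (A x) y = inner x (B y).
Proof.
move=> bA; have [M [M0 AM]] := bop_bound bA.
suff /choice [B HB] : forall y, exists z, forall x, inner (A x) y = inner x z.
  by exists B => x y; exact: HB.
move=> y; apply: (@riesz _ _ _ (M * rnorm y)) => [a x z|x].
  by rewrite (bopP bA) !innerE.
by rewrite (le_trans (ler_rnorm_inner _ _))// mulrAC ler_wpM2r ?rnorm_ge0.
Qed.

Lemma adjointP (A : H -> K) : bounded_operator A ->
  forall x y, inner (A x) y = inner x (adjoint A y).
Proof. by move=> /adjoint_exists; exact: (@getPex (K -> H)). Qed.

Lemma adjointPr (A : H -> K) : bounded_operator A ->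
  forall x y, inner y (A x) = inner (adjoint A y) x.
Proof. by move=> bA x y; rewrite innerC adjointP// -innerC. Qed.

Lemma adjoint_uniq (A : H -> K) (B : K -> H) :
  (forall x y, inner (A x) y = inner x (B y)) -> adjoint A = B.
Proof.
move=> AB; apply/funext => y; apply: inner_eqPr => x; rewrite -AB.
have : exists B', forall x y, inner (A x) y = inner x (B' y) by exists B.
by move=> /(@getPex (K -> H)) ->.
Qed.

Lemma adjoint_bound (A : H -> K) (M : R) : bounded_operator A -> 0 <= M ->
  (forall x, rnorm (A x) <= M * rnorm x) ->
  forall y, rnorm (adjoint A y) <= M * rnorm y.
Proof.
move=> bA M0 AM y; set z := adjoint A y.
have [->|z0] := eqVneq z 0; first by rewrite rnorm0 mulr_ge0 ?rnorm_ge0.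
have z1 : 0 < rnorm z by rewrite lt_neqAle eq_sym rnorm_eq0 z0 rnorm_ge0.
rewrite -(ler_pM2l z1) -expr2 sqr_rnorm {2}/z -adjointP//.
rewrite (le_trans (Re_le_rnorm _))// (le_trans (ler_rnorm_inner _ _))//.
by rewrite mulrA [_ * M]mulrC ler_wpM2r ?rnorm_ge0.
Qed.

Lemma bounded_adjoint (A : H -> K) : bounded_operator A ->
  bounded_operator (adjoint A).
Proof.
move=> bA; have [M [M0 AM]] := bop_bound bA; apply/bounded_operatorP; split.
  move=> a x y; apply: inner_eqPr => z.
  by rewrite -adjointP// !innerE !adjointP.
by exists M; split=> //; exact: adjoint_bound.
Qed.

End Adjoint.

Lemma adjointK (R : realType) (H K : hilbertType R) (A : H -> K) :
  bounded_operator A -> adjoint (adjoint A) = A.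
Proof. by move=> bA; apply: adjoint_uniq => x y; rewrite adjointPr. Qed.

Section Inverse.
Variables (R : realType) (H : hilbertType R).
Implicit Types A B N : H -> H.

Lemma op_invE A B : cancel A B -> cancel B A -> op_inv A = B.
Proof.
move=> AB BA; have : exists B', cancel A B' /\ cancel B' A by exists B.
move=> /(@getPex (H -> H)); rewrite -/(op_inv A) => -[AC CA].
by apply/funext => y; rewrite -{1}(BA y) AC.
Qed.

(** The iteration y |-> x + N y from 0 converges to the solution of y - N y = x. The bound (1 - r)
    |y| <= |y - N y| gives both uniqueness and boundedness of the inverse. *)
Lemma neumann N (r : R) : bounded_operator N -> r < 1 ->
  (forall x, rnorm (N x) <= r * rnorm x) ->
  exists G, [/\ bounded_operator G, cancel (fun x => x - N x) G &
                cancel G (fun x => x - N x)].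
Proof.
move=> bN r1 Nr.
have lb y : (1 - r) * rnorm y <= rnorm (y - N y).
  have := ler_rnormD (y - N y) (N y); rewrite subrK; have := Nr y; lra.
have r1' : 0 < 1 - r by lra.
have inj y : y - N y = 0 -> y = 0.
  move=> yN; have := lb y; rewrite yN rnorm0 pmulr_rle0// => y0.
  by apply/eqP; rewrite -rnorm_eq0 eq_le y0 rnorm_ge0.
have surj x : exists y, y - N y = x.
  (* The sign of r is free; a negative r forces x = 0. *)
  have [r_lt0|r0] := ltP r 0.
    exists 0; rewrite (bop0 bN) subr0; apply/esym/eqP; rewrite -rnorm_eq0.
    rewrite eq_le rnorm_ge0 andbT.
    by have := le_trans (rnorm_ge0 _) (Nr x); rewrite nmulr_rge0.
  pose u : nat -> H := fun k => iter k (fun y : H => x + N y) 0.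
  (* Tail of the geometric series: its decrements are exactly the bounds of [stepu]. *)
  pose q k := (1 - r)^-1 * rnorm x * r ^+ k.
  have stepu k : rnorm (u k - u k.+1) <= r ^+ k * rnorm x.
    elim: k => [|k IH]; first by rewrite /u /= (bop0 bN) addr0 sub0r rnormN mul1r.
    rewrite /u !iterS -/(u k) -/(u k.+1) opprD addrACA subrr add0r -(bopN bN).
    rewrite -(bopD bN) (le_trans (Nr _))// exprS -mulrA ler_wpM2l//.
  have qd k : q k - q k.+1 = r ^+ k * rnorm x.
    by rewrite /q exprS; field; rewrite lt0r_neq0.
  have uq k l : (k <= l)%N -> rnorm (u k - u l) <= q k - q l.
    elim: l => [|l IH]; first by rewrite leqn0 => /eqP ->; rewrite !subrr rnorm0.
    rewrite leq_eqVlt => /predU1P [->|kl]; first by rewrite !subrr rnorm0.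
    rewrite (le_trans (ler_rdistD (u l) _ _))//.
    by have := IH kl; have := stepu l; rewrite -qd; lra.
  have qc : q k @[k --> \oo] --> (1 - r)^-1 * rnorm x * 0.
    apply: cvgM; first exact: cvg_cst.
    by apply: cvg_expr; rewrite ger0_norm.
  have ucvg : cvg (u @ \oo).
    apply: (@expr_rnorm_cauchy_cvg _ _ 0 u q); first exact: cvgP qc.
    by move=> k l kl; rewrite expr1 (le_trans (uq _ _ kl))// ler_norm.
  move: ucvg => /cvg_ex [y uy]; exists y; apply/eqP; rewrite subr_eq; apply/eqP.
  apply: (@seq_cvg_unique _ _ (fun k => u k.+1)); first by rewrite cvg_shiftS.
  by apply: cvgD; [exact: cvg_cst|exact: bop_cvg].
have /choice [G GK] := surj.
have KG : cancel (fun x => x - N x) G.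
  move=> x; apply/eqP; rewrite -subr_eq0; apply/eqP/inj.
  rewrite (bopD bN) (bopN bN) opprD addrACA -opprD GK.
  by rewrite subrr.
exists G; split=> //; apply/bounded_operatorP; split.
  move=> a x y; apply: (can_inj KG); rewrite GK (bopP bN) opprD addrACA GK.
  by rewrite -scalerBr GK.
exists (1 - r)^-1; split; first by rewrite invr_ge0 ltW.
by move=> x; rewrite mulrC ler_pdivlMr// mulrC -{2}(GK x).
Qed.

End Inverse.

(** * Positive operators and monotone limits *)

Section PositiveOperators.
Variables (R : realType) (H : hilbertType R).
Implicit Types (A B : H -> H) (x y : H).

Lemma positive_Re A x : positive_operator A -> 0 <= complex.Re (inner (A x) x).
Proof. by move=> /(_ x); rewrite lecE => /andP[]. Qed.

Lemma positive_real A x : positive_operator A ->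
  inner (A x) x = (complex.Re (inner (A x) x))%:C%C.
Proof. by move=> /(_ x) A0; rewrite RRe_real// ger0_real. Qed.

(** Polarization over complex scalars: the diagonal values are real, and at x + y and x + i y this
    gives a + b = 0 and a = b for the two failures of symmetry. *)
Lemma positive_symmetric A : bounded_operator A -> positive_operator A ->
  forall x y, inner (A x) y = inner x (A y).
Proof.
move=> bA pA.
have diag x : inner (A x) x - inner x (A x) = 0.
  by rewrite [inner x _]innerC positive_real// conj_real subrr.
move=> x y; pose a := inner (A x) y - inner x (A y).
pose b := inner (A y) x - inner y (A x).
have h1 : a + b = 0.
  have := diag (x + y); rewrite (bopD bA) !innerE.
  have := diag x; have := diag y; rewrite /a /b.
  move=> /eqP; rewrite subr_eq0 => /eqP ->.
  move=> /eqP; rewrite subr_eq0 => /eqP -> <-.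
  by ring.
have h2 : a = b.
  have := diag (x + 'i *: y); rewrite (bopD bA) (bopZ bA) !innerE conjCi.
  have := diag x; have := diag y; rewrite /a /b.
  move=> /eqP; rewrite subr_eq0 => /eqP ->.
  move=> /eqP; rewrite subr_eq0 => /eqP -> h.
  have i0 : 'i != 0 :> R[i] by exact: neq0Ci.
  apply/eqP; rewrite -subr_eq0 -(mulrI_eq0 _ (mulfI i0)) -oppr_eq0 -h.
  by apply/eqP; ring.
apply/eqP; rewrite -subr_eq0 -/a; move: h1; rewrite -h2 -mulr2n => /eqP.
by rewrite mulrn_eq0.
Qed.

(** The form is nonnegative and vanishes at y, so y is a minimum; the first variation there is the
    pairing with A y, which [quad_cross] kills. *)
Lemma positive_kernel A y : bounded_operator A -> positive_operator A ->
  inner (A y) y = 0 -> A y = 0.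
Proof.
move=> bA pA Ay; apply: inner_eqPr => h.
rewrite inner0r -positive_symmetric//.
apply: (@quad_cross _ (complex.Re (inner (A h) h))).
  exact: positive_Re.
move=> t; have := positive_Re (y + t *: h) pA.
rewrite (bopD bA) (bopZ bA) !innerE Ay add0r (positive_symmetric bA pA y).
rewrite (innerC y) -rmorphM mulrDr (mulrA t) mulC_conj !ReD ReC ReZ.
by move=> h'; rewrite (le_trans h')// le_eqVlt; apply/orP; left; apply/eqP; ring.
Qed.

(** Add <A (x - A x), x - A x> >= 0 and <(1 - A) A x, A x> >= 0: the cubic terms cancel. This yields
    A^2 <= A before any square root exists. *)
Lemma sqr_rnorm_positive A x : bounded_operator A -> positive_operator A ->
  op_le A id -> rnorm (A x) ^+ 2 <= complex.Re (inner (A x) x).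
Proof.
move=> bA pA A1.
have := positive_Re (x - A x) pA; have := positive_Re (A x) A1.
rewrite (bopD bA) (bopN bA) !innerE -(positive_symmetric bA pA) !sqr_rnorm.
by rewrite !(ReD, ReN) (positive_symmetric bA pA (A x)) /=; lra.
Qed.

Lemma contractive_positive A x : bounded_operator A -> positive_operator A ->
  op_le A id -> rnorm (A x) <= rnorm x.
Proof.
move=> bA pA A1; have [->|Ax0] := eqVneq (A x) 0; first by rewrite rnorm0 rnorm_ge0.
have z1 : 0 < rnorm (A x) by rewrite lt_neqAle eq_sym rnorm_eq0 Ax0 rnorm_ge0.
rewrite -(ler_pM2l z1) -expr2 (le_trans (sqr_rnorm_positive x bA pA A1))//.
by rewrite (le_trans (Re_le_rnorm _))// ler_rnorm_inner.
Qed.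

Lemma cvg_rnorm (u : nat -> H) x :
  u @ \oo --> x -> rnorm (u k) @[k --> \oo] --> rnorm x.
Proof.
move=> /cvg_rnormP ux; apply/subr_cvg0/norm_cvg0P.
apply: (@squeeze_cvgr _ _ _ _ (fun=> 0) _ _ _ _ _ ux); last exact: cvg_cst.
apply: nearW => k; rewrite normr_ge0 /= ler_norml.
have := ler_rnormD (u k - x) x; have := ler_rnormD (x - u k) (u k).
by rewrite !subrK (rdistC x); lra.
Qed.

Section Decreasing.
Variable A : nat -> H -> H.
Hypotheses (bA : forall k, bounded_operator (A k))
  (pA : forall k, positive_operator (A k)) (A1 : op_le (A 0%N) id)
  (A_decr : forall k, op_le (A k.+1) (A k)).

Lemma decreasing_op_le k l : (k <= l)%N -> op_le (A l) (A k).
Proof.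
elim: l => [|l IH]; first by rewrite leqn0 => /eqP -> x; rewrite subrr inner0l.
rewrite leq_eqVlt => /predU1P [-> x|/IH kl x]; first by rewrite subrr inner0l.
rewrite -(subrK (A l x) (A k x)) -addrA innerDl addr_ge0//.
by have := A_decr l x.
Qed.

Lemma decreasing_le1 k : op_le (A k) id.
Proof.
move=> x; rewrite (_ : id x - A k x = (x - A 0%N x) + (A 0%N x - A k x));
  last by rewrite addrA subrK.
rewrite innerDl addr_ge0//.
exact: (decreasing_op_le (leq0n k) x).
Qed.

(** For k <= l the difference A k - A l again lies between 0 and 1, so the squared norm of its value
    at x is at most the drop of the monotone real sequence [q]. *)
Lemma decreasing_cvg x : cvg (A k x @[k --> \oo]).
Proof.
pose q k := complex.Re (inner (A k x) x).
have qd k l : (k <= l)%N -> q k - q l = complex.Re (inner (A k x - A l x) x).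
  by move=> kl; rewrite innerDl innerNl ReD ReN.
apply: (@expr_rnorm_cauchy_cvg _ _ 1 _ q).
  apply: nonincreasing_is_cvgn => [k l kl|].
    by rewrite -subr_ge0 qd// (positive_Re x (decreasing_op_le kl)).
  by exists 0 => _ [k _ <-]; exact: positive_Re.
move=> k l kl; rewrite (le_trans _ (ler_norm _))// qd//.
apply: (@sqr_rnorm_positive (fun x => A k x - A l x)).
- exact: bounded_sub.
- exact: decreasing_op_le.
move=> y; rewrite opprB addrCA innerDl addr_ge0//; first exact: pA.
exact: decreasing_le1.
Qed.

Definition strong_lim x : H := lim (A k x @[k --> \oo]).

Lemma strong_cvg x : A k x @[k --> \oo] --> strong_lim x.
Proof. exact: decreasing_cvg. Qed.

Lemma bounded_strong_lim : bounded_operator strong_lim.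
Proof.
apply/bounded_operatorP; split.
  move=> a x y. apply: (seq_cvg_unique (@strong_cvg _)).
  under eq_cvg do rewrite (bopP (bA _)).
  by apply: cvgD; [apply: cvgZr|]; exact: strong_cvg.
exists 1; split=> // x; rewrite mul1r.
apply: (cvgr_to_le (cvg_rnorm (@strong_cvg x))).
apply: nearW => k; apply: contractive_positive => //.
exact: decreasing_le1.
Qed.

Lemma closed_positive (B : nat -> H -> H) (L : H -> H) :
  (forall k, positive_operator (B k)) -> (forall x, B k x @[k --> \oo] --> L x) ->
  positive_operator L.
Proof.
move=> pB BL x.
have cx : inner (B k x) x @[k --> \oo] --> (inner (L x) x : R[i]^o).
  by apply: cvg_inner; [exact: BL|exact: cvg_cst].
have rL : complex.Re (inner (B k x) x) @[k --> \oo] --> complex.Re (inner (L x) x).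
  exact: cvg_Re.
have L0 : 0 <= complex.Re (inner (L x) x).
  by apply: (cvgr_to_ge rL); apply: nearW => k; exact: positive_Re.
(* Nonnegativity in [R[i]] includes being real, which the limit of the real parts does not show; a
   second limit proves that <L x, x> equals its conjugate. *)
rewrite (_ : inner (L x) x = (complex.Re (inner (L x) x))%:C%C) ?ler0c//.
rewrite RRe_real//; apply/CrealP; rewrite -innerC.
have cx' : inner (B k x) x @[k --> \oo] --> (inner x (L x) : R[i]^o).
  have Bxx k : inner (B k x) x = inner x (B k x).
    by rewrite [RHS]innerC positive_real// conj_real.
  under eq_cvg do rewrite Bxx.
  by apply: cvg_inner; [exact: cvg_cst|exact: BL].
exact: (@seq_cvg_unique R R[i]^o _ _ _ cx' cx).
Qed.

Lemma positive_strong_lim : positive_operator strong_lim.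
Proof. exact: (closed_positive pA strong_cvg). Qed.

Lemma strong_lim_le k : op_le strong_lim (A k).
Proof.
apply: (@closed_positive (fun l x => A k x - A (l + k)%N x)).
  by move=> l; apply: decreasing_op_le; rewrite leq_addl.
move=> x; apply: cvgB; first exact: cvg_cst.
by rewrite (@cvg_shiftn k _ (fun l => A l x)); exact: strong_cvg.
Qed.

Lemma le_strong_lim B : (forall k, op_le B (A k)) -> op_le B strong_lim.
Proof.
move=> BA; apply: (closed_positive BA) => x.
by apply: cvgB; [exact: strong_cvg|exact: cvg_cst].
Qed.

End Decreasing.

(* Powers of a positive operator are positive, and any two of these polynomials
   commute; this makes the iteration for the square root monotone. *)
Inductive nonneg_poly B : (H -> H) -> Prop :=
| nonneg_poly0 : nonneg_poly B (fun=> 0)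
| nonneg_polyM A : nonneg_poly B A -> nonneg_poly B (fun x => B (A x))
| nonneg_poly1 : nonneg_poly B id
| nonneg_polyD A A' : nonneg_poly B A -> nonneg_poly B A' ->
    nonneg_poly B (fun x => A x + A' x)
| nonneg_polyZ (c : R) A : 0 <= c -> nonneg_poly B A ->
    nonneg_poly B (fun x => c%:C%C *: A x).

End PositiveOperators.

(** * Square roots and defect operators *)

Section SquareRoot.
Variable R : realType.
Implicit Types H K : hilbertType R.

Section NonnegPoly.
Variables (H : hilbertType R) (B : H -> H).
Hypotheses (bB : bounded_operator B) (pB : positive_operator B).

Lemma bounded_nonneg_poly A : nonneg_poly B A -> bounded_operator A.
Proof.
elim=> [|? _|| ? ? _ ? _|c ? _ _]; [exact: bounded_zero|exact: bounded_comp|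
  exact: bounded_id|exact: bounded_add|exact: bounded_scale].
Qed.

Lemma nonneg_poly_commute C A : bounded_operator C ->
  (forall x, C (B x) = B (C x)) -> nonneg_poly B A -> forall x, C (A x) = A (C x).
Proof.
move=> bC CB; elim=> //= [x|A' _ IH x|A' A'' _ IH _ IH' x|c A' _ _ IH x].
- exact: bop0.
- by rewrite CB IH.
- by rewrite (bopD bC) IH IH'.
- by rewrite (bopZ bC) IH.
Qed.

Lemma nonneg_poly_comp A A' : nonneg_poly B A -> nonneg_poly B A' ->
  nonneg_poly B (fun x => A (A' x)).
Proof.
move=> pA pA'; elim: pA => //= *; by
  [exact: nonneg_poly0|exact: nonneg_polyM|exact: nonneg_polyD|exact: nonneg_polyZ].
Qed.

(** As A commutes with B, <B (B A x), x> = <A B x, B x>. Passing from A to B A therefore preserves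
    positivity only two factors at a time, so the induction carries A and B A together. *)
Lemma positive_nonneg_poly A : nonneg_poly B A -> positive_operator A.
Proof.
suff H0 : nonneg_poly B A -> nonneg_poly B A /\
    positive_operator A /\ positive_operator (fun x => B (A x)) by case/H0 => _ [].
elim=> [|{}A _ [npA [pA pBA]]||{}A A' _ [npA [pA pBA]] _ [npA' [pA' pBA']]|
    c {}A c0 _ [npA [pA pBA]]].
- split; first exact: nonneg_poly0.
  by split=> x; rewrite ?(bop0 bB) inner0l.
- split; first exact: nonneg_polyM.
  split=> // x; rewrite (positive_symmetric bB pB).
  rewrite (nonneg_poly_commute bB _ npA)//; exact: pA.
- split; first exact: nonneg_poly1.
  split=> // x; rewrite inner_norm; exact: exprn_ge0.
- split; first exact: nonneg_polyD.
  by split=> x; rewrite ?(bopD bB) innerDl addr_ge0.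
- split; first exact: nonneg_polyZ.
  by split=> x; rewrite ?(bopZ bB) innerZl mulr_ge0 ?ler0c.
Qed.

End NonnegPoly.

(* If [Y = (B + Y^2) / 2] then [(1 - Y)^2 = 1 - B]. *)
Fixpoint sqrt_iter H (B : H -> H) k : H -> H :=
  if k is k'.+1 then
    fun x => (2^-1)%:C%C *: (B x + sqrt_iter B k' (sqrt_iter B k' x))
  else fun=> 0.

Lemma halfC : (2^-1)%:C%C = 2^-1 :> R[i].
Proof. by rewrite fmorphV rmorph_nat. Qed.

Lemma half_ge0 : 0 <= 2^-1 :> R. Proof. by rewrite invr_ge0. Qed.

Section SqrtIter.
Variables (H : hilbertType R) (B : H -> H).
Hypotheses (bB : bounded_operator B) (pB : positive_operator B)
  (B1 : op_le B id).
Local Notation Y := (sqrt_iter B).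

Lemma sqrt_iterS k x : Y k.+1 x = (2^-1)%:C%C *: (B x + Y k (Y k x)).
Proof. by []. Qed.

Lemma nonneg_sqrt_iter k : nonneg_poly B (Y k).
Proof.
elim: k => [|k IH]; first exact: nonneg_poly0.
apply: nonneg_polyZ; first exact: half_ge0.
apply: nonneg_polyD; last exact: nonneg_poly_comp.
by apply: (@nonneg_polyM _ _ _ id); exact: nonneg_poly1.
Qed.

Lemma bounded_sqrt_iter k : bounded_operator (Y k).
Proof. by apply: bounded_nonneg_poly (nonneg_sqrt_iter k). Qed.

Lemma positive_sqrt_iter k : positive_operator (Y k).
Proof. by apply: positive_nonneg_poly (nonneg_sqrt_iter k). Qed.

Lemma sqrt_iter_commute k l x : Y k (Y l x) = Y l (Y k x).
Proof.
apply: nonneg_poly_commute (nonneg_sqrt_iter l) _; first exact: bounded_sqrt_iter.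
move=> {}x; apply/esym.
exact: nonneg_poly_commute (nonneg_sqrt_iter k) _.
Qed.

(** The iterates commute, so Y_{l+2} - Y_{l+1} is half of (Y_{l+1} + Y_l)(Y_{l+1} - Y_l). The
    induction shows that the differences are polynomials with nonnegative coefficients, a property
    that, unlike mere positivity, passes to products. *)
Lemma sqrt_iter_incr k : op_le (Y k) (Y k.+1).
Proof.
suff np l : nonneg_poly B (fun x => Y l.+1 x - Y l x).
  exact: positive_nonneg_poly (np k).
elim: l => [|l IH].
  rewrite (_ : (fun _ => _) = fun x => (2^-1)%:C%C *: B x).
    apply: nonneg_polyZ; first exact: half_ge0.
    by apply: (@nonneg_polyM _ _ _ id); exact: nonneg_poly1.
  by apply/funext => x /=; rewrite subr0 addr0.
rewrite (_ : (fun _ => _) = fun x => (2^-1)%:C%C *: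
    (Y l.+1 (Y l.+1 x - Y l x) + Y l (Y l.+1 x - Y l x))).
  apply: nonneg_polyZ; first exact: half_ge0.
  apply: nonneg_polyD; apply: nonneg_poly_comp => //; exact: nonneg_sqrt_iter.
apply/funext => x; rewrite [Y l.+2 x]sqrt_iterS [in X in _ - X = _]sqrt_iterS.
rewrite -scalerBr; congr (_ *: _).
rewrite !(bopD (bounded_sqrt_iter _)) !(bopN (bounded_sqrt_iter _)).
rewrite (sqrt_iter_commute l.+1 l).
move: (Y l.+1) (Y l) => Z W.
by apply: inner_eqP => z; rewrite !innerE; ring.
Qed.

Lemma sqrt_iter_le1 k : op_le (Y k) id.
Proof.
elim: k => [|k IH] x; first by rewrite /= subr0 inner_norm exprn_ge0.
have -> : id x - Y k.+1 x =
    (2^-1)%:C%C *: ((x - B x) + (x - Y k (Y k x))).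
  by apply: inner_eqP => z; rewrite /= !innerE halfC; field.
rewrite innerZl mulr_ge0 ?ler0c ?half_ge0// innerDl addr_ge0//.
rewrite innerDl innerNl (positive_symmetric (bounded_sqrt_iter k))//; last first.
  exact: positive_sqrt_iter.
rewrite !innerxx -rmorphB ler0c subr_ge0.
rewrite ler_pXn2r ?nnegrE ?rnorm_ge0//.
by apply: contractive_positive => //; [exact: bounded_sqrt_iter|
  exact: positive_sqrt_iter].
Qed.

End SqrtIter.

(** The iterates Y increase, whereas the monotone limit above is for decreasing sequences; 1 - Y
    decreases, and its limit is the root itself. *)
Definition pos_sqrt H (A : H -> H) : H -> H :=
  strong_lim (fun k x => x - sqrt_iter (fun y => y - A y) k x).

Section PosSqrt.
Variables (H : hilbertType R) (A : H -> H).
Hypotheses (bA : bounded_operator A) (pA : positive_operator A)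
  (A1 : op_le A id).
Local Notation B := (fun x : H => x - A x).

Let bB : bounded_operator B.
Proof. by apply: bounded_sub => //; exact: bounded_id. Qed.

Let B1 : op_le B id.
Proof. by move=> x; rewrite subKr; exact: pA. Qed.

Let bZ k : bounded_operator (fun x => x - sqrt_iter B k x).
Proof. by apply: bounded_sub; [exact: bounded_id|exact: bounded_sqrt_iter]. Qed.

Let pZ k : positive_operator (fun x => x - sqrt_iter B k x).
Proof. exact: sqrt_iter_le1. Qed.

Let Z1 : op_le (fun x => x - sqrt_iter B 0 x) id.
Proof. by move=> x; rewrite /= subr0 subrr inner0l. Qed.

Let Z_decr k :
  op_le (fun x => x - sqrt_iter B k.+1 x) (fun x => x - sqrt_iter B k x).
Proof.
move=> x; rewrite opprB [x - _ + _]addrC addrA subrK.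
exact: (sqrt_iter_incr bB A1 k x).
Qed.

Lemma pos_sqrt_cvg x : (x - sqrt_iter B k x) @[k --> \oo] --> pos_sqrt A x.
Proof. exact: strong_cvg. Qed.

Lemma bounded_pos_sqrt : bounded_operator (pos_sqrt A).
Proof. exact: bounded_strong_lim. Qed.

Lemma positive_pos_sqrt : positive_operator (pos_sqrt A).
Proof. exact: positive_strong_lim. Qed.

Lemma sqrt_iter_cvg x : sqrt_iter B k x @[k --> \oo] --> x - pos_sqrt A x.
Proof.
rewrite (_ : (fun k => _) = fun k => x - (x - sqrt_iter B k x)).
  by apply: cvgB; [exact: cvg_cst|exact: pos_sqrt_cvg].
by apply/funext => k; rewrite subKr.
Qed.

Lemma pos_sqrtK x : pos_sqrt A (pos_sqrt A x) = A x.
Proof.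
pose Y := sqrt_iter B; pose L x := x - pos_sqrt A x.
have bL : bounded_operator L.
  by apply: bounded_sub; [exact: bounded_id|exact: bounded_pos_sqrt].
(* Operator and vector both vary with k; contractivity of Y k absorbs the variation of the vector,
   so strong convergence is enough. *)
have YYL : Y k (Y k x) @[k --> \oo] --> L (L x).
  apply: (@cvg_rnorm_le _ _ _ _ (fun k => rnorm (Y k x - L x) +
      rnorm (Y k (L x) - L (L x)))).
    move=> k; rewrite (le_trans (ler_rdistD (Y k (L x)) _ _))// lerD2r.
    rewrite -(bopN (bounded_sqrt_iter _ _)) -?(bopD (bounded_sqrt_iter _ _))//.
    apply: contractive_positive; [exact: bounded_sqrt_iter|
      exact: positive_sqrt_iter|exact: sqrt_iter_le1].
  rewrite -[0]addr0; apply: cvgD; apply/cvg_rnormP; exact: sqrt_iter_cvg.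
have eqL : L x = (2^-1)%:C%C *: (B x + L (L x)).
  apply: (@seq_cvg_unique _ _ (fun k => Y k.+1 x)).
    by rewrite (@cvg_shiftS _ (fun k => Y k x)); exact: sqrt_iter_cvg.
  by apply: cvgZr; apply: cvgD => //; exact: cvg_cst.
have : 2%:R *: L x = B x + L (L x).
  by rewrite {1}eqL scalerA halfC divff ?scale1r// pnatr_eq0.
rewrite /L !(bopD bounded_pos_sqrt) (bopN bounded_pos_sqrt).
move: (pos_sqrt A) => P PE; apply: inner_eqP => z.
move: PE => /(congr1 (fun v => inner v z)) /eqP; rewrite -subr_eq0 => /eqP PE.
by apply/eqP; rewrite -subr_eq0 -oppr_eq0 -PE !innerE; apply/eqP; ring.
Qed.

End PosSqrt.
End SquareRoot.

Section Intertwining.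
Variables (R : realType) (H K : hilbertType R) (A : H -> H) (A' : K -> K).
Hypotheses (bA : bounded_operator A) (pA : positive_operator A)
  (A1 : op_le A id).
Hypotheses (bA' : bounded_operator A') (pA' : positive_operator A')
  (A1' : op_le A' id).

(** S intertwines all the iterates, hence their limits. Taken with another root as S it gives
    commutation with [pos_sqrt]; taken with a contraction C it gives C D_C = D_{C^*} C. *)
Lemma pos_sqrt_intertwine (S : H -> K) : bounded_operator S ->
  (forall x, S (A x) = A' (S x)) ->
  forall x, S (pos_sqrt A x) = pos_sqrt A' (S x).
Proof.
move=> bS SA x.
pose Y k := sqrt_iter (fun y => y - A y) k.
pose Y' k := sqrt_iter (fun y => y - A' y) k.
have SY k y : S (Y k y) = Y' k (S y).
  elim: k y => [|k IH] y; first exact: (bop0 bS).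
  rewrite /Y /Y' !sqrt_iterS (bopZ bS) (bopD bS) -/(Y k) -/(Y' k) !IH.
  by rewrite (bopD bS) (bopN bS) SA.
have c1 y : S (y - Y k y) @[k --> \oo] --> S (pos_sqrt A y).
  by apply: bop_cvg => //; exact: pos_sqrt_cvg.
apply: (seq_cvg_unique (c1 x)).
rewrite (_ : (fun k => _) = fun k => S x - Y' k (S x)); first exact: pos_sqrt_cvg.
by apply/funext => k; rewrite (bopD bS) (bopN bS) SY.
Qed.

End Intertwining.

Section SqrtUnique.
Variables (R : realType) (H : hilbertType R) (A : H -> H).
Hypotheses (bA : bounded_operator A) (pA : positive_operator A)
  (A1 : op_le A id).

(** P and Q commute and have the same square, so (P + Q) y = 0 for y = (P - Q) x. The nonnegative
    numbers <P y, y> and <Q y, y> then both vanish, so P y = Q y = 0 and |y|^2 = <x, (P - Q) y> =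
    0. *)
Lemma pos_sqrt_unique (Q : H -> H) : bounded_operator Q -> positive_operator Q ->
  (forall x, Q (Q x) = A x) -> Q = pos_sqrt A.
Proof.
move=> bQ pQ QQ; apply/funext => x; set P := pos_sqrt A.
have bP : bounded_operator P by exact: bounded_pos_sqrt.
have pP : positive_operator P by exact: positive_pos_sqrt.
have PP y : P (P y) = A y by exact: pos_sqrtK.
have QP y : Q (P y) = P (Q y).
  by apply: pos_sqrt_intertwine => // z; rewrite -!QQ.
have key y : P (P y - Q y) + Q (P y - Q y) = 0.
  by rewrite !(bopD bP, bopD bQ, bopN bP, bopN bQ) QP PP QQ addrA subrK subrr.
pose y := P x - Q x.
have h : inner (P y) y + inner (Q y) y = 0 by rewrite -innerDl key inner0l.
have [/eqP Py0 /eqP Qy0] : inner (P y) y == 0 /\ inner (Q y) y == 0.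
  by move/eqP: h; rewrite paddr_eq0; [move=> /andP[]|exact: pP|exact: pQ].
have Py : P y = 0 by exact: positive_kernel.
have Qy : Q y = 0 by exact: positive_kernel.
have : inner y y = 0.
  rewrite {1}/y innerDl innerNl (positive_symmetric bP pP).
  by rewrite (positive_symmetric bQ pQ) Py Qy inner0r subrr.
rewrite inner_norm => /eqP; rewrite sqrf_eq0 normr_eq0 subr_eq0 => /eqP.
by [].
Qed.

Lemma op_sqrtE : op_sqrt A = pos_sqrt A.
Proof.
have : exists B : H -> H,
    [/\ bounded_operator B, positive_operator B & forall x, B (B x) = A x].
  exists (pos_sqrt A); split; [exact: bounded_pos_sqrt|exact: positive_pos_sqrt|].
  exact: pos_sqrtK.
by move=> /(@getPex (H -> H)) [bB pB BB]; exact: pos_sqrt_unique.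
Qed.

End SqrtUnique.

Section Defect.
Variables (R : realType).
Implicit Types H K : hilbertType R.

Definition contractive H K (C : H -> K) := forall x, rnorm (C x) <= rnorm x.

Lemma contractive_adjoint H K (C : H -> K) : bounded_operator C ->
  contractive C -> contractive (adjoint C).
Proof.
move=> bC cC y; rewrite -[leRHS]mul1r; apply: adjoint_bound => // x.
by rewrite mul1r.
Qed.

Section DefectOperator.
Variables (H K : hilbertType R) (C : H -> K).
Hypotheses (bC : bounded_operator C) (cC : contractive C).
Local Notation A := (fun x => x - adjoint C (C x)).

Lemma bounded_defect_sqr : bounded_operator A.
Proof.
apply: bounded_sub; first exact: bounded_id.
by apply: bounded_comp => //; exact: bounded_adjoint.
Qed.

Lemma positive_defect_sqr : positive_operator A.
Proof.
move=> x; rewrite innerDl innerNl -adjointPr// !innerxx -rmorphB ler0c subr_ge0.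
by rewrite ler_pXn2r ?nnegrE ?rnorm_ge0.
Qed.

Lemma defect_sqr_le1 : op_le A id.
Proof.
move=> x; rewrite subKr -adjointPr// innerxx ler0c exprn_ge0// rnorm_ge0.
Qed.

Lemma defect_opE : defect_op C = pos_sqrt A.
Proof.
exact: (op_sqrtE bounded_defect_sqr positive_defect_sqr defect_sqr_le1).
Qed.

Lemma bounded_defect : bounded_operator (defect_op C).
Proof.
rewrite defect_opE; exact: (bounded_pos_sqrt bounded_defect_sqr
  positive_defect_sqr defect_sqr_le1).
Qed.

Lemma positive_defect : positive_operator (defect_op C).
Proof.
rewrite defect_opE; exact: (positive_pos_sqrt bounded_defect_sqr
  positive_defect_sqr defect_sqr_le1).
Qed.

Lemma defectK x : defect_op C (defect_op C x) = x - adjoint C (C x).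
Proof.
rewrite defect_opE; exact: (pos_sqrtK bounded_defect_sqr
  positive_defect_sqr defect_sqr_le1).
Qed.

Lemma defect_symmetric x y :
  inner (defect_op C x) y = inner x (defect_op C y).
Proof. exact: positive_symmetric bounded_defect positive_defect x y. Qed.

(** Eliminates the square root: the isometries behind the coincidence are verified in this form. *)
Lemma inner_defect x y :
  inner (defect_op C x) (defect_op C y) = inner x y - inner (C x) (C y).
Proof.
by rewrite defect_symmetric defectK innerDr innerNr -adjointP.
Qed.

Lemma defect_unique (Q : H -> H) : bounded_operator Q -> positive_operator Q ->
  (forall x, Q (Q x) = x - adjoint C (C x)) -> defect_op C = Q.
Proof.
move=> bQ pQ QQ; rewrite defect_opE; apply/esym.
exact: (pos_sqrt_unique bounded_defect_sqr positive_defect_sqr defect_sqr_le1).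
Qed.

End DefectOperator.

Lemma defect_intertwine H K (C : H -> K) : bounded_operator C -> contractive C ->
  forall x, C (defect_op C x) = defect_op (adjoint C) (C x).
Proof.
move=> bC cC x; have bC' := bounded_adjoint bC.
have cC' := contractive_adjoint bC cC.
rewrite !defect_opE//; apply: pos_sqrt_intertwine => //.
- exact: bounded_defect_sqr.
- exact: positive_defect_sqr.
- exact: defect_sqr_le1.
- exact: bounded_defect_sqr.
- exact: positive_defect_sqr.
- exact: defect_sqr_le1.
by move=> y; rewrite (bopD bC) (bopN bC) adjointK.
Qed.

End Defect.

(** * Row operators *)

Section RowOperators.
Variables (R : realType) (n : nat) (H : hilbertType R).
Local Notation C := R[i].
Local Notation Hn := (dsum n H).
Implicit Types (T : 'I_n -> H -> H) (z w : 'rV[C]_n) (h : Hn) (x y : H).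

Lemma inner_dsumE h (k : Hn) : inner h k = \sum_i inner (h i) (k i).
Proof. by []. Qed.

Lemma rnorm_proj h i : rnorm (h i) <= rnorm h.
Proof. by rewrite -lecR -!normE; exact: dsum_norm_proj. Qed.

Lemma bounded_proj i : bounded_operator (fun h => h i).
Proof.
apply/bounded_operatorP; split=> [a h k|]; first by rewrite !ffunE.
by exists 1; split=> // h; rewrite mul1r rnorm_proj.
Qed.

Lemma bounded_row_op T : (forall i, bounded_operator (T i)) ->
  bounded_operator (row_op T).
Proof.
by move=> bT; apply: bounded_sum => i; apply: bounded_comp; last exact: bounded_proj.
Qed.

Lemma adjoint_row_op T : (forall i, bounded_operator (T i)) ->
  adjoint (row_op T) = fun y => [ffun i => adjoint (T i) y].
Proof.
move=> bT; apply: adjoint_uniq => h y.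
rewrite inner_suml inner_dsumE; apply: eq_bigr => i _.
by rewrite ffunE adjointP.
Qed.

Lemma bounded_scalar_entry z i : bounded_operator (fun x : H => z ord0 i *: x).
Proof. by apply: bounded_scale; exact: bounded_id. Qed.

Lemma bounded_scalar_row z : bounded_operator (scalar_row z : Hn -> H).
Proof. by apply: bounded_row_op => i; exact: bounded_scalar_entry. Qed.

Lemma adjoint_scalar_row z :
  adjoint (scalar_row z : Hn -> H) = fun y => [ffun i => (z ord0 i)^* *: y].
Proof.
rewrite adjoint_row_op => [|i]; last exact: bounded_scalar_entry.
apply/funext => y; apply/ffunP => i; rewrite !ffunE.
rewrite (@adjoint_uniq _ _ _ _ (fun x => (z ord0 i)^* *: x))// => a b.
by rewrite !innerE conjCK.
Qed.

Lemma scalar_row_adjoint z w x :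
  scalar_row z (adjoint (scalar_row w) x) = cdot z w *: x.
Proof.
rewrite adjoint_scalar_row /scalar_row /row_op scaler_suml.
by apply: eq_bigr => i _; rewrite ffunE scalerA.
Qed.

Lemma cdot_real z : cdot z z = (complex.Re (cdot z z))%:C%C.
Proof.
by rewrite RRe_real// ger0_real// sumr_ge0// => i _; rewrite -normCK exprn_ge0.
Qed.

Lemma cdot_ge0 z : 0 <= complex.Re (cdot z z).
Proof.
by rewrite -ler0c -cdot_real sumr_ge0// => i _; rewrite -normCK exprn_ge0.
Qed.

(** As row operators z z^* = |z|^2, so z and z^* are bounded by |z| < 1. This r is the ratio of
    every Neumann series below. *)
Lemma scalar_row_bound z : unit_ball z -> exists r : R, [/\ 0 <= r, r < 1,
  forall h, rnorm (scalar_row z h) <= r * rnorm h &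
  forall x, rnorm (adjoint (scalar_row z : Hn -> H) x) <= r * rnorm x].
Proof.
rewrite /unit_ball /= cdot_real => zb; have := zb.
rewrite -[1]/(1%:C)%C ltcR => z1.
pose r := Num.sqrt (complex.Re (cdot z z)).
have r0 : 0 <= r by exact: sqrtr_ge0.
have adj x : rnorm (adjoint (scalar_row z : Hn -> H) x) <= r * rnorm x.
  rewrite -(@ler_pXn2r _ 2) ?nnegrE ?mulr_ge0 ?rnorm_ge0// exprMn sqr_sqrtr ?cdot_ge0//.
  rewrite sqr_rnorm -adjointP; last exact: bounded_scalar_row.
  by rewrite scalar_row_adjoint innerZl cdot_real ReZ -sqr_rnorm.
exists r; split=> //.
  by rewrite -sqrtr1 ltr_sqrt.
move=> h; rewrite -[scalar_row z]adjointK; last exact: bounded_scalar_row.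
apply: adjoint_bound => //; apply: bounded_adjoint; exact: bounded_scalar_row.
Qed.

(** In this form a tuple enters rho only through the adjoint of its row, which is what
    [adjoint_involution_row] computes for the Moebius transform. *)
Lemma rhoE T X x y : (forall i, bounded_operator (T i)) ->
  inner (rho T X x) y =
  inner ([ffun i => X (adjoint (row_op T) x i)] : Hn) (adjoint (row_op T) y).
Proof.
move=> bT; rewrite /rho inner_suml inner_dsumE adjoint_row_op//.
by apply: eq_bigr => i _; rewrite !ffunE adjointP.
Qed.

(** rho_T(1) = T T^*, so the inequality says that T^* is contractive, and contractivity passes to
    adjoints. *)
Lemma row_contractive T : (forall i, bounded_operator (T i)) ->
  op_le (rho T id) id <-> contractive (row_op T).
Proof.
move=> bT; have bR := bounded_row_op bT.
have bA := bounded_adjoint bR.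
suff -> : op_le (rho T id) id <-> contractive (adjoint (row_op T)).
  split=> [|/(contractive_adjoint bR)//].
  by move=> /(contractive_adjoint bA); rewrite adjointK.
have E x : inner (rho T id x) x = (rnorm (adjoint (row_op T) x) ^+ 2)%:C%C.
  rewrite rhoE// -innerxx; congr (inner _ _); apply/ffunP => i.
  by rewrite ffunE.
split=> [T1 x|T1 x].
  have := T1 x; rewrite innerDl innerNl E innerxx -rmorphB ler0c subr_ge0.
  by rewrite ler_pXn2r ?nnegrE ?rnorm_ge0.
rewrite innerDl innerNl E innerxx -rmorphB ler0c subr_ge0.
by rewrite ler_pXn2r ?nnegrE ?rnorm_ge0.
Qed.

Lemma row_op_dsum_inj (A : Hn -> H) : bounded_operator A ->
  forall h, row_op (row_entry A) h = A h.
Proof.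
move=> bA h; rewrite /row_op /row_entry -(bop_sum bA); congr (A _).
apply/ffunP => i; rewrite sum_ffunE (bigD1 i)//= ffunE eqxx big1 ?addr0// => j ji.
by rewrite ffunE eq_sym (negbTE ji).
Qed.

Lemma bounded_dsum_inj i : bounded_operator (@dsum_inj R n H i).
Proof.
apply/bounded_operatorP; split=> [a x y|].
  by apply/ffunP => j; rewrite !ffunE; case: eqP => // _; rewrite scaler0 addr0.
exists 1; split=> // x; rewrite mul1r -(@ler_pXn2r _ 2) ?nnegrE ?rnorm_ge0//.
rewrite !sqr_rnorm inner_dsumE (bigD1 i)//= ffunE eqxx big1 ?addr0// => j ji.
by rewrite ffunE (negbTE ji) inner0l.
Qed.

Lemma bounded_row_entry (A : Hn -> H) i : bounded_operator A ->
  bounded_operator (row_entry A i).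
Proof. by move=> bA; apply: bounded_comp => //; exact: bounded_dsum_inj. Qed.

End RowOperators.

(** * The Moebius transform of a tuple *)

Section TensorMatrix.
Variables (R : realType) (n : nat) (H : hilbertType R).
Local Notation C := R[i].
Local Notation Hn := (dsum n H).
Implicit Types (A B : 'M[C]_n) (h k : Hn).

Lemma tensor_mxE A h i : tensor_mx A h i = \sum_j A i j *: h j.
Proof. by rewrite ffunE. Qed.

Lemma bounded_tensor_mx A : bounded_operator (@tensor_mx R n H A).
Proof.
rewrite (_ : tensor_mx A = fun h : Hn =>
    \sum_i dsum_inj i (\sum_j A i j *: h j)); last first.
  apply/funext => h; apply/ffunP => i.
  rewrite tensor_mxE sum_ffunE [in RHS](bigD1 i)//= [dsum_inj _ _ _]ffunE eqxx.
  by rewrite [X in _ + X]big1 ?addr0// => j ji; rewrite ffunE eq_sym (negbTE ji).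
apply: bounded_sum => i; apply: bounded_comp; first exact: bounded_dsum_inj.
apply: bounded_sum => j; apply: bounded_scale; exact: bounded_proj.
Qed.

Lemma tensor_mxM A B h : tensor_mx A (tensor_mx B h) = tensor_mx (A *m B) h.
Proof.
apply/ffunP => i; rewrite !tensor_mxE.
under eq_bigr do rewrite tensor_mxE scaler_sumr.
rewrite exchange_big; apply: eq_bigr => j _; rewrite mxE scaler_suml.
by apply: eq_bigr => k _; rewrite scalerA.
Qed.

Lemma tensor_mx1 h : tensor_mx 1%:M h = h.
Proof.
apply/ffunP => i; rewrite tensor_mxE (bigD1 i)//= mxE eqxx scale1r.
by rewrite big1 ?addr0// => j ji; rewrite mxE eq_sym (negbTE ji) scale0r.
Qed.

Lemma inner_tensor_mx A h k :
  inner (tensor_mx A h) k = inner h (tensor_mx (A^t* )%sesqui k).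
Proof.
rewrite !inner_dsumE.
under eq_bigr do rewrite tensor_mxE inner_suml.
rewrite exchange_big; apply: eq_bigr => j _; rewrite tensor_mxE inner_sumr.
by apply: eq_bigr => i _; rewrite !mxE !innerE conjCK.
Qed.

Lemma tensor_mx_unitaryK A : A \is unitarymx ->
  cancel (@tensor_mx R n H A) (tensor_mx (A^t* )%sesqui) /\
  cancel (tensor_mx (A^t* )%sesqui) (@tensor_mx R n H A).
Proof.
move=> /unitarymxP AA; split=> h; rewrite tensor_mxM ?AA ?tensor_mx1//.
by rewrite (mulmx1C AA) tensor_mx1.
Qed.

Lemma scalar_row_tensor_mx (z : 'rV[C]_n) A h :
  scalar_row z (tensor_mx A h) = scalar_row (z *m A) h.
Proof.
rewrite /scalar_row /row_op.
under eq_bigr do rewrite tensor_mxE scaler_sumr.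
rewrite exchange_big; apply: eq_bigr => j _; rewrite mxE scaler_suml.
by apply: eq_bigr => i _; rewrite scalerA.
Qed.

End TensorMatrix.

Section Moebius.
Variables (R : realType) (n : nat) (H : hilbertType R).
Variables (lambda : 'rV[R[i]]_n) (T : 'I_n -> H -> H).
Hypotheses (lambda_ball : unit_ball lambda)
  (bT : forall i, bounded_operator (T i)) (cT : contractive (row_op T)).
Local Notation C := R[i].
Local Notation Hn := (dsum n H).
Local Notation s := (s_ lambda).
Local Notation c := (1 + s)^-1.
Local Notation L := (scalar_row lambda : Hn -> H).
Local Notation Lc := (adjoint (scalar_row lambda : Hn -> H)).
Local Notation Tr := (row_op T).
Local Notation Tc := (adjoint (row_op T)).

Lemma s_gt0 : 0 < s.
Proof. by rewrite sqrtC_gt0 subr_gt0. Qed.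

Lemma s_conj : s^* = s.
Proof. by apply/CrealP; rewrite ger0_real// ltW// s_gt0. Qed.

Lemma sN_conj : (- s)^* = - s.
Proof. by apply/CrealP; rewrite rpredN ger0_real// ltW// s_gt0. Qed.

Lemma s_neq0 : s != 0.
Proof. by rewrite gt_eqF// s_gt0. Qed.

Lemma s1_neq0 : 1 + s != 0.
Proof. by rewrite gt_eqF// addr_gt0// s_gt0. Qed.

Lemma c_conj : c^* = c.
Proof.
by apply/CrealP; rewrite ger0_real// invr_ge0 addr_ge0// ltW// s_gt0.
Qed.

Lemma cdot_s : cdot lambda lambda = 1 - s ^+ 2.
Proof. by rewrite sqrtCK subKr. Qed.

Let bTr : bounded_operator Tr := bounded_row_op bT.
Let bTc : bounded_operator Tc := bounded_adjoint bTr.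
Let bL : bounded_operator L := @bounded_scalar_row R n H lambda.
Let bLc : bounded_operator Lc := bounded_adjoint bL.
Let cTc : contractive Tc := contractive_adjoint bTr cT.

(** Since L L^* = |lambda|^2 = 1 - s^2, the square of 1 - c L^* L is 1 - (2 c - c^2 (1 - s^2)) L^*
    L, and c = 1 / (1 + s) makes the coefficient 1. For nonzero lambda this c is (1 - s) /
    |lambda|^2; written with 1 + s it also covers lambda = 0. *)
Lemma defect_scalar_row :
  defect_op L = fun h => h - c *: Lc (L h).
Proof.
have [r [r0 r1 Lr Lcr]] := @scalar_row_bound R n H _ lambda_ball.
have cL : contractive L.
  by move=> h; rewrite (le_trans (Lr h))// ler_piMl ?rnorm_ge0 ?ltW.
apply: defect_unique => //.
- apply: bounded_sub; first exact: bounded_id.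
  by apply: bounded_scale; exact: bounded_comp.
- move=> h; rewrite innerDl innerNl innerZl -adjointPr// subr_ge0.
  rewrite (@le_trans _ _ (1 * inner (L h) (L h)))//.
    rewrite ler_wpM2r ?inner_norm ?exprn_ge0//.
    by rewrite invf_le1 ?addr_gt0 ?s_gt0// lerDl ltW ?s_gt0.
  by rewrite mul1r !innerxx lecR ler_pXn2r ?nnegrE ?rnorm_ge0.
move=> h; rewrite (bopD bL) (bopN bL) (bopZ bL) scalar_row_adjoint cdot_s.
rewrite (bopD bLc) (bopN bLc) !(bopZ bLc).
apply: inner_eqP => z; rewrite !innerE.
by field; exact: s1_neq0.
Qed.

Lemma defect_adjoint_scalar_row :
  defect_op Lc = fun x => s *: x.
Proof.
have [r [r0 r1 Lr Lcr]] := @scalar_row_bound R n H _ lambda_ball.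
have cLc : contractive Lc.
  by move=> h; rewrite (le_trans (Lcr h))// ler_piMl ?rnorm_ge0 ?ltW.
apply: defect_unique => //.
- by apply: bounded_scale; exact: bounded_id.
- move=> x; rewrite innerZl inner_norm mulr_ge0 ?exprn_ge0//.
  by rewrite ltW// s_gt0.
move=> x; rewrite adjointK// scalar_row_adjoint cdot_s.
by apply: inner_eqP => z; rewrite !innerE; ring.
Qed.

Definition resolvent : H -> H := op_inv (fun x => x - Tr (Lc x)).
Local Notation G := resolvent.

Lemma resolventP : [/\ bounded_operator G,
  forall x, G (x - Tr (Lc x)) = x & forall x, G x - Tr (Lc (G x)) = x].
Proof.
have [r [r0 r1 Lr Lcr]] := @scalar_row_bound R n H _ lambda_ball.
have [||G [bG KG GK]] := @neumann R H (fun x => Tr (Lc x)) r _ r1.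
- exact: bounded_comp.
- by move=> x; rewrite (le_trans (cT _)).
by rewrite /resolvent (op_invE KG GK).
Qed.

Let bG : bounded_operator G. Proof. by case: resolventP. Qed.
Let bGc : bounded_operator (adjoint G) := bounded_adjoint bG.

Lemma adjoint_resolventK x :
  adjoint G x - L (Tc (adjoint G x)) = x.
Proof.
case: resolventP => _ KG _; apply: inner_eqPr => z.
rewrite innerDr innerNr adjointPr// adjointPr// adjointK// -!adjointP//.
by rewrite -[in RHS](KG z) (bopD bG) (bopN bG) innerDl innerNl.
Qed.

Lemma adjoint_resolvent_id x : adjoint G (x - L (Tc x)) = x.
Proof.
case: resolventP => _ _ GK; apply: inner_eqPr => z.
rewrite -adjointP// innerDr innerNr adjointPr// adjointPr// adjointK//.
by rewrite -innerNl -innerDl GK.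
Qed.

Local Notation V := (involution_row lambda T).

Lemma involution_rowE h :
  V h = c *: L h - s *: G (Tr h) + (s * c) *: G (L h).
Proof.
case: resolventP => _ KG _.
rewrite /involution_row defect_adjoint_scalar_row defect_scalar_row -/G.
(* The resolvent identity G T L^* = G - 1, applied to L h. *)
have GN : G (Tr (Lc (L h))) = G (L h) - L h.
  by rewrite -[X in _ = _ - X]KG (bopD bG) (bopN bG) subKr.
rewrite (bopD bTr) (bopN bTr) (bopZ bTr) (bopD bG) (bopN bG) (bopZ bG) GN.
by apply: inner_eqP => z; rewrite !innerE; field; exact: s1_neq0.
Qed.

Lemma bounded_involution_row : bounded_operator V.
Proof.
rewrite (_ : V = fun h => c *: L h - s *: G (Tr h) + (s * c) *: G (L h)).
  apply: bounded_add; last by apply: bounded_scale; exact: bounded_comp.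
  by apply: bounded_sub; apply: bounded_scale => //; exact: bounded_comp.
by apply/funext => h; exact: involution_rowE.
Qed.

Lemma adjoint_involution_row x (xi := adjoint G x) :
  adjoint V x = c *: Lc (x + s *: xi) - s *: Tc xi.
Proof.
rewrite /xi; suff -> : adjoint V = fun x =>
    c *: Lc (x + s *: adjoint G x) - s *: Tc (adjoint G x) by [].
apply: adjoint_uniq => h y; rewrite involution_rowE !innerE s_conj c_conj.
rewrite !(bopD bLc, bopZ bLc) !innerE s_conj -!adjointP//.
by rewrite !(adjointP bG); ring.
Qed.

(* As an operator identity:
   [X - rho_{phi(T)}(X) = s^2 G (X - rho_T(X)) G^*] with [G = (1 - T L^* )^-1]. *)
Lemma involution_row_form (X : H -> H) x y (xi := adjoint G x) (eta := adjoint G y) :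
  bounded_operator X ->
  let Xn (h : Hn) : Hn := [ffun i => X (h i)] in
  inner (X x) y - inner (Xn (adjoint V x)) (adjoint V y) =
  s ^+ 2 * (inner (X xi) eta - inner (Xn (Tc xi)) (Tc eta)).
Proof.
move=> bX Xn.
have XnD h k : Xn (h + k) = Xn h + Xn k.
  by apply/ffunP => i; rewrite !ffunE (bopD bX).
have XnZ a h : Xn (a *: h) = a *: Xn h.
  by apply/ffunP => i; rewrite !ffunE (bopZ bX).
(* The entries of L are scalars, so X commutes with L and L^*. With L T^* xi = xi - x, every pairing
   other than that of T^* xi with T^* eta reduces to x, y, xi, eta, and only coefficients remain to
   be compared. *)
have XnL x' : Xn (Lc x') = Lc (X x').
  by rewrite adjoint_scalar_row; apply/ffunP => i; rewrite !ffunE (bopZ bX).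
have LXn h : L (Xn h) = X (L h).
  rewrite /scalar_row /row_op (bop_sum bX); apply: eq_bigr => i _.
  by rewrite ffunE (bopZ bX).
have LLc x' : L (Lc x') = (1 - s ^+ 2) *: x' by rewrite scalar_row_adjoint cdot_s.
have LTc : L (Tc xi) = xi - x by rewrite -(adjoint_resolventK x) subKr.
have LTc' : L (Tc eta) = eta - y by rewrite -(adjoint_resolventK y) subKr.
rewrite !adjoint_involution_row -/xi -/eta -!scaleNr !(XnD, XnZ, XnL).
rewrite !innerE sN_conj c_conj.
rewrite -!(adjointP bL) -!(adjointPr bL) LXn LLc LTc LTc'.
rewrite !(bopD bX, bopN bX, bopZ bX) !innerE s_conj.
by field; exact: s1_neq0.
Qed.

End Moebius.

(** * The limit operator as a largest fixed point *)

Section LargestFixedPoint.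
Variables (R : realType) (n : nat) (H : hilbertType R) (T : 'I_n -> H -> H).
Hypotheses (bT : forall i, bounded_operator (T i)) (cT : contractive (row_op T)).
Local Notation A k := (iter k (rho T) id).

Lemma bounded_rho X : bounded_operator X -> bounded_operator (rho T X).
Proof.
move=> bX; apply: bounded_sum => i; apply: bounded_comp => //.
by apply: bounded_comp => //; exact: bounded_adjoint.
Qed.

Lemma rho_le X Y : op_le X Y -> op_le (rho T X) (rho T Y).
Proof.
move=> XY x; rewrite innerDl innerNl /rho !inner_suml -sumrB sumr_ge0// => i _.
by rewrite !(adjointP (bT i)) -innerNl -innerDl; exact: (XY (adjoint (T i) x)).
Qed.

Lemma bounded_rho_iter k : bounded_operator (A k).
Proof. by elim: k => [|k IH]; [exact: bounded_id|exact: bounded_rho]. Qed.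

Lemma rho_iter_decr k : op_le (A k.+1) (A k).
Proof.
by elim: k => [|k IH]; [exact/row_contractive|exact: rho_le].
Qed.

Lemma positive_rho_iter k : positive_operator (A k).
Proof.
elim: k => [|k IH] x; first by rewrite inner_norm exprn_ge0.
rewrite /= /rho inner_suml sumr_ge0// => i _; rewrite (adjointP (bT i)); exact: IH.
Qed.

Lemma rho_iter0_le1 : op_le (A 0%N) id.
Proof. by move=> x; rewrite subrr inner0l. Qed.

Lemma A_infty_cvg x : A k x @[k --> \oo] --> A_infty T x.
Proof.
exact: (strong_cvg bounded_rho_iter positive_rho_iter rho_iter0_le1 rho_iter_decr).
Qed.

Lemma bounded_A_infty : bounded_operator (A_infty T).
Proof.
exact: (bounded_strong_lim bounded_rho_iter positive_rho_iter rho_iter0_le1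
  rho_iter_decr).
Qed.

Lemma A_infty_le1 : op_le (A_infty T) id.
Proof.
exact: (strong_lim_le bounded_rho_iter positive_rho_iter rho_iter0_le1
  rho_iter_decr 0%N).
Qed.

Lemma rho_A_infty x : rho T (A_infty T) x = A_infty T x.
Proof.
apply: (@seq_cvg_unique _ _ (fun k => A k.+1 x));
  last by rewrite (@cvg_shiftS _ (fun k => A k x)); exact: A_infty_cvg.
by apply: seq_cvg_sum => i; apply: bop_cvg => //; exact: A_infty_cvg.
Qed.

(** Monotonicity of rho_T turns X <= 1 into X = rho_T^k(X) <= rho_T^k(1) for every k. *)
Lemma fixed_le_A_infty X : rho T X = X -> op_le X id -> op_le X (A_infty T).
Proof.
move=> XE X1.
apply: (le_strong_lim bounded_rho_iter positive_rho_iter rho_iter0_le1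
  rho_iter_decr) => k.
by elim: k => [//|k IH]; rewrite -XE; exact: rho_le.
Qed.

End LargestFixedPoint.

Lemma op_le_antisym (R : realType) (H : hilbertType R) (X Y : H -> H) :
  bounded_operator X -> bounded_operator Y -> op_le X Y -> op_le Y X -> X = Y.
Proof.
move=> bX bY XY YX; apply/funext => x; apply/esym/eqP; rewrite -subr_eq0; apply/eqP.
apply: (@positive_kernel _ _ (fun x => Y x - X x)) => //; first exact: bounded_sub.
apply/eqP; rewrite eq_le XY -oppr_ge0 -innerNl opprB andbT; exact: YX.
Qed.

Section MoebiusTuple.
Variables (R : realType) (n : nat) (H : hilbertType R).
Variables (lambda : 'rV[R[i]]_n) (omega : 'M[R[i]]_n) (T : 'I_n -> H -> H).
Hypotheses (lambda_ball : unit_ball lambda) (omegaU : omega \is unitarymx)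
  (bT : forall i, bounded_operator (T i)) (cT : contractive (row_op T)).
Local Notation C := R[i].
Local Notation Hn := (dsum n H).
Local Notation s := (s_ lambda).
Local Notation V := (involution_row lambda T).
Local Notation G := (resolvent lambda T).
Local Notation L := (scalar_row lambda : Hn -> H).
Local Notation Tc := (adjoint (row_op T)).
Local Notation alphaT := (aut_tuple lambda omega T).

Lemma bounded_aut_row : bounded_operator (V \o tensor_mx omega).
Proof.
apply: (@bounded_comp _ _ _ _ V); last exact: bounded_tensor_mx.
exact: bounded_involution_row.
Qed.

Lemma bounded_aut_tuple i : bounded_operator (alphaT i).
Proof. by apply: bounded_row_entry; exact: bounded_aut_row. Qed.

Lemma row_aut_tuple : row_op alphaT = V \o tensor_mx omega.
Proof. by apply/funext => h; apply: row_op_dsum_inj; exact: bounded_aut_row. Qed.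

Lemma adjoint_row_aut_tuple :
  adjoint (row_op alphaT) = tensor_mx (omega^t* )%sesqui \o adjoint V.
Proof.
apply: adjoint_uniq => h y; rewrite row_aut_tuple /= adjointP.
  by rewrite inner_tensor_mx.
exact: bounded_involution_row.
Qed.

(** The unitary drops out: the adjoint of 1 (x) omega commutes with the entrywise action of X and
    preserves inner products, so [involution_row_form] applies. *)
Lemma aut_tuple_form (X : H -> H) x y : bounded_operator X ->
  inner (X x) y - inner (rho alphaT X x) y =
  s ^+ 2 * (inner (X (adjoint G x)) (adjoint G y) -
            inner (rho T X (adjoint G x)) (adjoint G y)).
Proof.
move=> bX; rewrite !rhoE//; last exact: bounded_aut_tuple.
rewrite -(involution_row_form lambda_ball bT cT x y bX).
congr (_ - _); rewrite adjoint_row_aut_tuple /= -[RHS]/(inner _ _).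
have -> : [ffun i => X (tensor_mx (omega^t* )%sesqui (adjoint V x) i)] =
    tensor_mx (omega^t* )%sesqui [ffun i => X (adjoint V x i)] :> Hn.
  apply/ffunP => i; rewrite ffunE !tensor_mxE (bop_sum bX).
  by apply: eq_bigr => j _; rewrite (bopZ bX) ffunE.
rewrite -inner_tensor_mx.
by have [_ ->] := tensor_mx_unitaryK H omegaU.
Qed.

Lemma contractive_aut_tuple : contractive (row_op alphaT).
Proof.
apply/row_contractive; first exact: bounded_aut_tuple.
move=> x; rewrite innerDl innerNl (aut_tuple_form x x (bounded_id H)).
apply: mulr_ge0; first by rewrite exprn_ge0// ltW// s_gt0.
have := iffRL (row_contractive bT) cT (adjoint G x).
by rewrite innerDl innerNl.
Qed.

(** One direction substitutes directly. For the other, G^* maps x - L T^* x to x, so the identity at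
    such vectors reaches all x and y, and s is nonzero. *)
Lemma aut_tuple_fixed X : bounded_operator X -> rho alphaT X = X <-> rho T X = X.
Proof.
move=> bX; split=> XE; apply/funext => x; apply: inner_eqP => y; apply/eqP;
  rewrite eq_sym -subr_eq0.
- pose x' := x - L (Tc x); pose y' := y - L (Tc y).
  have := aut_tuple_form x' y' bX; rewrite XE subrr => /esym/eqP.
  rewrite mulf_eq0 expf_eq0 (negbTE (s_neq0 lambda_ball)) /=.
  by rewrite !(adjoint_resolvent_id lambda_ball bT cT).
- by rewrite aut_tuple_form// XE subrr mulr0.
Qed.

Lemma A_infty_aut_tuple : A_infty alphaT = A_infty T.
Proof.
have bA := bounded_aut_tuple; have cA := contractive_aut_tuple.
have bX := bounded_A_infty bA cA; have bY := bounded_A_infty bT cT.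
apply: op_le_antisym => //.
  apply: fixed_le_A_infty => //; last exact: A_infty_le1.
  by apply/aut_tuple_fixed => //; apply/funext => x; exact: rho_A_infty.
apply: fixed_le_A_infty => //; last exact: A_infty_le1.
by apply/aut_tuple_fixed => //; apply/funext => x; exact: rho_A_infty.
Qed.

End MoebiusTuple.

(** * Coincidence of characteristic functions *)

Section UnitaryExtension.
Variables (R : realType) (X H K : hilbertType R) (P : X -> H) (Q : X -> K).

(* The closure of the relation [P u ~ Q u]: it is the graph of the unitary
   extension of [P u |-> Q u]. *)
Definition limit_rel (x : H) (y : K) := exists u : nat -> X,
  P (u k) @[k --> \oo] --> x /\ Q (u k) @[k --> \oo] --> y.

Hypotheses (bP : bounded_operator P) (bQ : bounded_operator Q)
  (PQ : forall u v, inner (P u) (P v) = inner (Q u) (Q v)).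

Lemma limit_rel_total x : closure (range P) x -> exists y, limit_rel x y.
Proof.
move=> /closure_seqP [v Pv vx].
have /choice [u Pu] : forall k, exists w, P w = v k.
  by move=> k; have [w _ Pw] := Pv k; exists w.
have Pux : P (u k) @[k --> \oo] --> x by under eq_cvg do rewrite Pu.
have : cvg (Q (u k) @[k --> \oo]).
  apply: cauchy_rnorm_cvg => e e0.
  have /cvg_rnormP/cvgr0Pnorm_lt /(_ (e / 2)) [|N _ HN] := Pux.
    by rewrite divr_gt0.
  exists N => k l Nk Nl.
  have -> : rnorm (Q (u k) - Q (u l)) = rnorm (P (u k) - P (u l)).
    apply/eqP; rewrite -(@eqrXn2 _ 2) ?rnorm_ge0// !sqr_rnorm.
    rewrite -!(bopN bP, bopN bQ) -(bopD bP) -(bopD bQ) PQ //.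
  rewrite (le_lt_trans (ler_rdistD x _ _))// (splitr e) ltrD//.
    by have := HN _ Nk; rewrite /= ger0_norm ?rnorm_ge0.
  by have := HN _ Nl; rewrite /= ger0_norm ?rnorm_ge0// rdistC.
by move=> /cvg_ex [y Quy]; exists y, u.
Qed.

Lemma limit_rel_inner x x' y y' : limit_rel x y -> limit_rel x' y' ->
  inner x x' = inner y y'.
Proof.
move=> [u [ux uy]] [v [vx vy]].
apply: (@seq_cvg_unique R R[i]^o _ _ _ (cvg_inner ux vx)).
by under eq_cvg do rewrite PQ; exact: cvg_inner.
Qed.

Lemma limit_relP a x x' y y' : limit_rel x y -> limit_rel x' y' ->
  limit_rel (a *: x + x') (a *: y + y').
Proof.
move=> [u [ux uy]] [v [vx vy]]; exists (fun k => a *: u k + v k).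
under eq_cvg do rewrite (bopP bP).
under [X in _ /\ X]eq_cvg do rewrite (bopP bQ).
by split; apply: cvgD => //; exact: cvgZr.
Qed.

Lemma limit_rel_fun x y y' : limit_rel x y -> limit_rel x y' -> y = y'.
Proof.
move=> xy xy'; apply/eqP; rewrite -subr_eq0 -rnorm_eq0 -sqrf_eq0 sqr_rnorm.
(* Subtracting the two relations relates 0 to y - y', and related pairs have equal inner
   products. *)
have d := limit_relP (-1) xy' xy; rewrite !scaleN1r addNr in d.
rewrite [y - y']addrC -(limit_rel_inner d d).
by rewrite inner0l.
Qed.

Lemma limit_rel_closure x y : limit_rel x y ->
  closure (range P) x /\ closure (range Q) y.
Proof.
move=> [u [ux uy]]; split; apply/closure_seqP.
  by exists (fun k => P (u k)) => // k; exists (u k).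
by exists (fun k => Q (u k)) => // k; exists (u k).
Qed.

End UnitaryExtension.

Lemma limit_rel_sym (R : realType) (X H K : hilbertType R) (P : X -> H)
  (Q : X -> K) x y : limit_rel P Q x y -> limit_rel Q P y x.
Proof. by move=> [u [ux uy]]; exists u. Qed.

(** [limit_rel] is symmetric in P and Q: its totality and single-valuedness in the reverse direction
    are surjectivity and injectivity of U. The relation is returned along with U so that identities
    for U can be checked on approximating sequences. *)
Lemma unitary_extension (R : realType) (X H K : hilbertType R)
    (P : X -> H) (Q : X -> K) :
  bounded_operator P -> bounded_operator Q ->
  (forall u v, inner (P u) (P v) = inner (Q u) (Q v)) ->
  exists U, unitary_on (closure (range P)) (closure (range Q)) U /\
    forall x, closure (range P) x -> limit_rel P Q x (U x).
Proof.
move=> bP bQ PQ.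
have /choice [U HU] : forall x, exists y,
    closure (range P) x -> limit_rel P Q x y.
  move=> x; have [Px|nPx] := pselect (closure (range P) x); last by exists 0.
  by have [y xy] := limit_rel_total bP bQ PQ Px; exists y.
exists U; split => //; split.
- split.
  + by move=> x /HU/limit_rel_closure[].
  + move=> x y; rewrite !in_setE => /HU Ux /HU Uy xy.
    apply: (limit_rel_fun bQ bP) (limit_rel_sym Ux) _; last first.
      by rewrite xy; exact: limit_rel_sym.
    by move=> u v; rewrite PQ.
  + move=> y Qy; have QP u v : inner (Q u) (Q v) = inner (P u) (P v) by rewrite PQ.
    have [x /limit_rel_sym xy] := limit_rel_total bQ bP QP Qy.
    have [Px _] := limit_rel_closure xy.
    by exists x => //; exact: (limit_rel_fun bP bQ PQ (HU _ Px) xy).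
- move=> a x y Px Py.
  have r := limit_relP bP bQ a (HU _ Px) (HU _ Py).
  have [Pxy _] := limit_rel_closure r.
  exact: (limit_rel_fun bP bQ PQ (HU _ Pxy) r).
- by move=> x y Px Py; rewrite (limit_rel_inner PQ (HU _ Px) (HU _ Py)).
Qed.

(** * The characteristic function on defect vectors *)

Section CharFun.
Variables (R : realType) (n : nat) (H : hilbertType R) (T : 'I_n -> H -> H).
Hypotheses (bT : forall i, bounded_operator (T i)) (cT : contractive (row_op T)).
Local Notation C := R[i].
Local Notation Hn := (dsum n H).
Local Notation Tr := (row_op T).
Local Notation Tc := (adjoint (row_op T)).
Variable z : 'rV[C]_n.
Hypothesis z_ball : unit_ball z.

Let bTr : bounded_operator Tr := bounded_row_op bT.
Let bTc : bounded_operator Tc := bounded_adjoint bTr.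
Let cTc : contractive Tc := contractive_adjoint bTr cT.
Let bz : bounded_operator (scalar_row z : Hn -> H) := @bounded_scalar_row R n H z.

Lemma char_fun_resolvent : exists G : H -> H, [/\ bounded_operator G,
  op_inv (fun x => x - scalar_row z (Tc x)) = G,
  forall x, G (x - scalar_row z (Tc x)) = x &
  forall x, G x - scalar_row z (Tc (G x)) = x].
Proof.
have [r [r0 r1 zr _]] := @scalar_row_bound R n H _ z_ball.
have [||G [bG KG GK]] := @neumann R H (fun x => scalar_row z (Tc x)) r _ r1.
- exact: bounded_comp.
- by move=> x; rewrite (le_trans (zr _))// ler_wpM2l.
by exists G; rewrite (op_invE KG GK).
Qed.

Lemma bounded_char_fun : bounded_operator (char_fun T z).
Proof.
have [G [bG E _ _]] := char_fun_resolvent.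
rewrite /char_fun; apply: bounded_add; first exact: bounded_opp.
apply: bounded_comp; first exact: bounded_defect.
rewrite E; apply: bounded_comp => //; apply: bounded_comp => //.
exact: bounded_defect.
Qed.

Lemma char_fun_defect h y : y - scalar_row z (Tc y) = scalar_row z h - Tr h ->
  char_fun T z (defect_op Tr h) = defect_op Tc y.
Proof.
have [G [bG E KG _]] := char_fun_resolvent.
move=> yE; rewrite /char_fun E defectK// defect_intertwine//.
(* (1 - z T^* ) (y + T h) = z (1 - T^* T) h. So the second term of [char_fun] is D_{T^*} (y + T h),
   and its part D_{T^*} T h cancels against T D_T h. *)
have -> : G (scalar_row z (h - Tc (Tr h))) = y + Tr h.
  rewrite -[RHS]KG (bopD bTc) (bopD bz); congr G.
  rewrite (bopD bz) (bopN bz) opprD addrACA yE.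
  by apply: inner_eqP => t; rewrite !innerE; ring.
by rewrite (bopD (bounded_defect bTc cTc)) addrC addrK.
Qed.

Lemma char_fun_solve h : exists y, y - scalar_row z (Tc y) = scalar_row z h - Tr h.
Proof.
have [G [_ _ _ GK]] := char_fun_resolvent.
by exists (G (scalar_row z h - Tr h)).
Qed.

Lemma char_fun_homo :
  {homo char_fun T z : x / defect_space Tr x >-> defect_space Tc x}.
Proof.
move=> x /closure_seqP [u Du ux]; apply/closure_seqP.
exists (fun k => char_fun T z (u k)) => [k|]; last first.
  by apply: bop_cvg => //; exact: bounded_char_fun.
have [h _ <-] := Du k; have [y yE] := char_fun_solve h.
by exists y => //; rewrite (char_fun_defect yE).
Qed.

End CharFun.

(** * Involutions of the ball *)

Section BallInvolution.
Variables (R : realType) (n : nat).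
Implicit Types z w lambda : 'rV[R[i]]_n.

(** From 2 |<z, w>| <= |z|^2 + |w|^2 < 2. *)
Lemma cdot_neq1 z w : unit_ball z -> unit_ball w -> 1 - cdot z w != 0.
Proof.
rewrite /unit_ball /= => zb wb; rewrite subr_eq0; apply/eqP => zw.
have h : 2 * `|cdot z w| <= cdot z z + cdot w w.
  apply: (@le_trans _ _ (2 * \sum_i `|z ord0 i * (w ord0 i)^*|)).
    by rewrite ler_wpM2l// ler_norm_sum.
  rewrite mulr_sumr /cdot -big_split ler_sum// => i _.
  rewrite normrM norm_conjC -!normCK -subr_ge0 /=.
  have : `|z ord0 i| - `|w ord0 i| \is Num.real by rewrite rpredB ?normr_real.
  move: (`|z ord0 i|) (`|w ord0 i|) => a b ab.
  rewrite (_ : _ - _ = (a - b) ^+ 2); first by rewrite real_exprn_even_ge0.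
  by ring.
have := le_lt_trans h (ltrD zb wb).
by rewrite -zw normr1 mulr1 -[1 + 1]/(2%:R) ltxx.
Qed.

(** Scalar analogue of [involution_rowE], with 1 / (1 - <w, lambda>) in place of G. At lambda = 0
    the quotient in [proj_span] is 0 by convention, and <w, lambda> is 0 as well. *)
Lemma ball_involution_coef lambda w : unit_ball lambda -> unit_ball w ->
  ball_involution lambda w =
  ((1 + s_ lambda)^-1 * (1 + s_ lambda / (1 - cdot w lambda))) *: lambda -
  (s_ lambda / (1 - cdot w lambda)) *: w.
Proof.
move=> lb wb; have u1 := cdot_neq1 wb lb.
have s1 := s1_neq0 lb.
have E : (1 - s_ lambda) * (cdot w lambda / cdot lambda lambda) =
    cdot w lambda / (1 + s_ lambda).
  have [l0|l0] := eqVneq (cdot lambda lambda) 0.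
    have /eqP : lambda = 0.
      apply/rowP => i; rewrite mxE; apply/eqP; rewrite -normr_eq0 -sqrf_eq0.
      move/eqP: l0; rewrite psumr_eq0 => [|j _]; last by rewrite -normCK exprn_ge0.
      by move=> /allP /(_ i (mem_index_enum _)); rewrite -normCK.
    move=> /eqP ->; rewrite {1}/cdot big1 ?mul0r ?mulr0.
      by rewrite /cdot big1 ?mul0r// => i _; rewrite !mxE rmorph0 mulr0.
    by move=> i _; rewrite !mxE rmorph0 mulr0.
  move: l0; rewrite cdot_s => l0.
  by field; rewrite s1.
rewrite /ball_involution /proj_span scalerA E.
apply/rowP => i; rewrite !mxE.
by field; rewrite u1 s1.
Qed.

End BallInvolution.

Section Coincidence.
Variables (R : realType) (n : nat) (H : hilbertType R).
Variables (lambda : 'rV[R[i]]_n) (omega : 'M[R[i]]_n) (T : 'I_n -> H -> H).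
Hypotheses (lambda_ball : unit_ball lambda) (omegaU : omega \is unitarymx)
  (bT : forall i, bounded_operator (T i)) (cT : contractive (row_op T)).
Local Notation C := R[i].
Local Notation Hn := (dsum n H).
Local Notation s := (s_ lambda).
Local Notation c := (1 + s)^-1.
Local Notation V := (involution_row lambda T).
Local Notation G := (resolvent lambda T).
Local Notation L := (scalar_row lambda : Hn -> H).
Local Notation Lc := (adjoint (scalar_row lambda : Hn -> H)).
Local Notation Tr := (row_op T).
Local Notation Tc := (adjoint (row_op T)).
Local Notation A := (row_op (aut_tuple lambda omega T)).
Local Notation Ac := (adjoint (row_op (aut_tuple lambda omega T))).
Local Notation Om := (@tensor_mx R n H omega).
Local Notation Omc := (@tensor_mx R n H (omega^t* )%sesqui).

Let bTr : bounded_operator Tr := bounded_row_op bT.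
Let bTc : bounded_operator Tc := bounded_adjoint bTr.
Let cTc : contractive Tc := contractive_adjoint bTr cT.
Let bL : bounded_operator L := @bounded_scalar_row R n H lambda.
Let bLc : bounded_operator Lc := bounded_adjoint bL.
Let bAi i : bounded_operator (aut_tuple lambda omega T i) :=
  bounded_aut_tuple omega lambda_ball bT cT i.
Let bA : bounded_operator A := bounded_row_op bAi.
Let bAc : bounded_operator Ac := bounded_adjoint bA.
Let cA : contractive A := contractive_aut_tuple lambda_ball omegaU bT cT.
Let cAc : contractive Ac := contractive_adjoint bA cA.

Lemma scalar_row_adjoint_s x : L (Lc x) = (1 - s ^+ 2) *: x.
Proof. by rewrite scalar_row_adjoint cdot_s. Qed.

(* [D_L^-1 (1 - L^* T)], where [D_L^-1 = 1 + L^* L / (s (1 + s))]. *)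
Definition defect_param (k : Hn) : Hn := k + Lc ((c / s) *: L k - s^-1 *: Tr k).

Lemma bounded_defect_param : bounded_operator defect_param.
Proof.
apply: bounded_add; first exact: bounded_id.
by apply: bounded_comp => //; apply: bounded_sub; exact: bounded_scale.
Qed.

Lemma defect_param_surj g : exists k, defect_param k = g.
Proof.
have [_ _ GK] := resolventP lambda_ball bT cT.
(* d is D_L g, and (1 - L^* T)^-1 = 1 + L^* G T reduces the inverse on the direct sum to the
   resolvent on H. *)
pose d := g - c *: Lc (L g); pose y := G (Tr d).
have yE : Tr (Lc y) = y - Tr d by rewrite -(GK (Tr d)) -/y subKr.
exists (d + Lc y).
have TE : Tr (d + Lc y) = y by rewrite (bopD bTr) yE addrC subrK.
rewrite /defect_param TE (bopD bL) scalar_row_adjoint_s /d.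
rewrite (bopD bL) (bopN bL) (bopZ bL) scalar_row_adjoint_s.
rewrite !(bopD bLc, bopN bLc, bopZ bLc).
apply: inner_eqP => t; rewrite !innerE.
by field; rewrite (s_neq0 lambda_ball) (s1_neq0 lambda_ball).
Qed.

(** This is the point of [defect_param]: by G T L^* = G - 1 the resolvent disappears from phi(T) on
    the parametrized vectors. *)
Lemma involution_row_param k :
  V (defect_param k) = s^-1 *: (L k - Tr k).
Proof.
have [bG KG _] := resolventP lambda_ball bT cT.
have GN x : G (Tr (Lc x)) = G x - x.
  by rewrite -[X in _ = _ - X]KG (bopD bG) (bopN bG) subKr.
rewrite (involution_rowE lambda_ball bT cT) /defect_param.
rewrite (bopD bL) (bopD bTr) scalar_row_adjoint_s !(bopD bG) GN.
rewrite !(bopD bG, bopN bG, bopZ bG).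
apply: inner_eqP => t; rewrite !innerE.
by field; rewrite (s_neq0 lambda_ball) (s1_neq0 lambda_ball).
Qed.

(** By [inner_defect] the two sides are inner products of defect vectors, of phi(T) at the
    parametrized vectors and of T at k and k'. *)
Lemma inner_defect_param k k' :
  inner (defect_param k) (defect_param k') -
    inner (V (defect_param k)) (V (defect_param k')) =
  inner k k' - inner (Tr k) (Tr k').
Proof.
rewrite !involution_row_param /defect_param.
have aC : (c / s)^* = c / s.
  by apply/CrealP; rewrite ger0_real// divr_ge0 ?invr_ge0 ?addr_ge0 ?ltW ?s_gt0.
have bC : (s^-1)^* = s^-1.
  by apply/CrealP; rewrite ger0_real// invr_ge0 ltW ?s_gt0.
rewrite !innerE -!(adjointP bL) -!(adjointPr bL) scalar_row_adjoint_s !innerE aC bC.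
by field; rewrite (s_neq0 lambda_ball) (s1_neq0 lambda_ball).
Qed.

Lemma aut_row_param k : A (Omc (defect_param k)) = s^-1 *: (L k - Tr k).
Proof.
rewrite (row_aut_tuple omega lambda_ball bT cT) /=.
by have [_ ->] := tensor_mx_unitaryK H omegaU; exact: involution_row_param.
Qed.

(* The unitaries intertwining the characteristic functions send
   [dom_map_aut k] to [dom_map k] and [cod_map_aut x] to [cod_map x]. *)
Definition dom_map_aut (k : Hn) : Hn := defect_op A (Omc (defect_param k)).
Definition dom_map (k : Hn) : Hn := - defect_op Tr k.
Definition cod_map_aut (x : H) : H := defect_op Ac (x - L (Tc x)).
Definition cod_map (x : H) : H := s *: defect_op Tc x.

Lemma bounded_dom_map_aut : bounded_operator dom_map_aut.
Proof.
apply: bounded_comp; first exact: bounded_defect.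
by apply: bounded_comp; [exact: bounded_tensor_mx|exact: bounded_defect_param].
Qed.

Lemma bounded_dom_map : bounded_operator dom_map.
Proof. by apply: bounded_opp; exact: bounded_defect. Qed.

Lemma bounded_cod_map_aut : bounded_operator cod_map_aut.
Proof.
apply: bounded_comp; first exact: bounded_defect.
by apply: bounded_sub; [exact: bounded_id|exact: bounded_comp].
Qed.

Lemma bounded_cod_map : bounded_operator cod_map.
Proof. by apply: bounded_scale; exact: bounded_defect. Qed.

Lemma inner_dom_map k k' :
  inner (dom_map_aut k) (dom_map_aut k') = inner (dom_map k) (dom_map k').
Proof.
rewrite /dom_map_aut /dom_map innerNl innerNr opprK !inner_defect// !aut_row_param.
rewrite -!involution_row_param -inner_defect_param; congr (_ - _).
have [_ K'] := tensor_mx_unitaryK H omegaU.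
by rewrite -inner_tensor_mx K'.
Qed.

Lemma inner_cod_map x y :
  inner (cod_map_aut x) (cod_map_aut y) = inner (cod_map x) (cod_map y).
Proof.
rewrite /cod_map_aut /cod_map innerZl innerZr (s_conj lambda_ball) !inner_defect//.
rewrite mulrA -expr2.
have := aut_tuple_form lambda_ball omegaU bT cT (x - L (Tc x)) (y - L (Tc y))
  (bounded_id H).
rewrite !(adjoint_resolvent_id lambda_ball bT cT) !rhoE//.
rewrite (_ : [ffun i => Ac _ i] = Ac (x - L (Tc x)) :> Hn); last first.
  by apply/ffunP => i; rewrite ffunE.
by rewrite (_ : [ffun i => Tc _ i] = Tc x :> Hn)//; apply/ffunP => i; rewrite ffunE.
Qed.

Lemma range_dom_map_aut : range dom_map_aut = range (defect_op A).
Proof.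
apply/seteqP; split=> _ [k _ <-]; first by exists (Omc (defect_param k)).
have [k' k'E] := defect_param_surj (Om k); exists k' => //.
by rewrite /dom_map_aut k'E; have [-> _] := tensor_mx_unitaryK H omegaU.
Qed.

Lemma range_dom_map : range dom_map = range (defect_op Tr).
Proof.
have bD := bounded_defect bTr cT.
apply/seteqP; split=> _ [k _ <-]; exists (- k) => //; rewrite ?/dom_map (bopN bD)//.
exact: opprK.
Qed.

Lemma range_cod_map_aut : range cod_map_aut = range (defect_op Ac).
Proof.
apply/seteqP; split=> _ [x _ <-]; first by exists (x - L (Tc x)).
exists (adjoint G x) => //.
by rewrite /cod_map_aut (adjoint_resolventK lambda_ball bT cT).
Qed.

Lemma range_cod_map : range cod_map = range (defect_op Tc).
Proof.
have bD := bounded_defect bTc cTc.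
apply/seteqP; split=> _ [x _ <-]; first by exists (s *: x) => //; rewrite (bopZ bD).
exists (s^-1 *: x) => //; rewrite /cod_map (bopZ bD) scalerA divff ?scale1r//.
exact: s_neq0.
Qed.

(** Through [char_fun_defect] each value amounts to solving a linear equation. One solution eta at w
    serves both: (1 - L T^* ) eta, scaled by - 1 / s, solves the equation of the transformed tuple
    at z. *)
Lemma char_fun_param (w : 'rV[C]_n) k :
  let z := ball_involution lambda w *m omega in
  unit_ball w -> unit_ball z -> exists x,
  char_fun (aut_tuple lambda omega T) z (dom_map_aut k) = cod_map_aut x /\
  char_fun T w (dom_map k) = cod_map x.
Proof.
move=> z wb zb.
have [eta etaE] := char_fun_solve bT cT wb k.
have u1 := cdot_neq1 wb lambda_ball.
(* The sign matches the one in [dom_map], and 1 / s undoes the factor s of [cod_map]. *)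
exists (- s^-1 *: eta); split; last first.
  rewrite /dom_map /cod_map (bopN (bounded_char_fun bT cT wb)).
  rewrite (char_fun_defect bT cT wb etaE).
  rewrite (bopZ (bounded_defect bTc cTc)) scalerA mulrN divff ?scaleN1r//.
  exact: s_neq0.
rewrite /dom_map_aut /cod_map_aut; apply: (char_fun_defect bAi cA zb).
pose x := eta - L (Tc eta).
have -> : - s^-1 *: eta - L (Tc (- s^-1 *: eta)) = - s^-1 *: x.
  by rewrite (bopZ bTc) (bopZ bL) -scalerBr.
rewrite aut_row_param (bopZ bAc).
rewrite (adjoint_row_aut_tuple omega lambda_ball bT cT) /=.
rewrite /z -!scalar_row_tensor_mx.
have [_ K'] := tensor_mx_unitaryK H omegaU.
have zZ (a : C) (h : Hn) : scalar_row (ball_involution lambda w) (Om (a *: h)) =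
    a *: scalar_row (ball_involution lambda w) (Om h).
  rewrite (bopZ (@bounded_tensor_mx R n H omega)).
  by rewrite (bopZ (@bounded_scalar_row R n H _)).
rewrite zZ !K' ball_involution_coef//.
set beta := c * _; set gamma := s / _.
have phiE (h : Hn) : scalar_row (beta *: lambda - gamma *: w) h =
    beta *: L h - gamma *: scalar_row w h.
  rewrite /scalar_row /row_op !scaler_sumr -sumrB; apply: eq_bigr => i _.
  by rewrite !mxE !scalerA -scalerBl.
rewrite !phiE (adjoint_involution_row lambda_ball bT cT).
rewrite (adjoint_resolvent_id lambda_ball bT cT).
have bw := @bounded_scalar_row R n H w.
have LTc : L (Tc eta) = eta - x by rewrite subKr.
have wTc : scalar_row w (Tc eta) = eta - (scalar_row w k - Tr k).
  by rewrite -etaE subKr.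
rewrite /defect_param.
rewrite !(bopD bL, bopN bL, bopZ bL, bopD bw, bopN bw, bopZ bw) LTc wTc.
rewrite !scalar_row_adjoint_s !scalar_row_adjoint /beta /gamma.
apply: inner_eqP => t; rewrite !innerE.
by field; rewrite ?s_neq0 ?s1_neq0 ?u1.
Qed.

Lemma coincide_aut_tuple (alpha : 'rV[C]_n -> 'rV[C]_n) :
  set_bij (@unit_ball R n) (@unit_ball R n) alpha ->
  (forall z, unit_ball z -> alpha z = ball_involution lambda z *m omega) ->
  coincide (defect_space A) (defect_space Ac)
    (char_fun (aut_tuple lambda omega T)) (defect_space Tr) (defect_space Tc)
    (fun z => char_fun T (ball_inverse alpha z)).
Proof.
move=> [_ _ asurj] alphaE.
have inv_ball z : unit_ball z -> unit_ball (ball_inverse alpha z).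
  by move=> zb; apply: (surjpinv_image_sub asurj); exists z.
have inv_K z : unit_ball z -> alpha (ball_inverse alpha z) = z.
  by move=> zb; apply: (surjpK _ asurj); rewrite in_setE.
split.
- by move=> z zb; exact: char_fun_homo.
- by move=> z zb; apply: char_fun_homo => //; exact: inv_ball.
have [U1 [U1u U1r]] :=
  unitary_extension bounded_dom_map_aut bounded_dom_map inner_dom_map.
have [U2 [U2u U2r]] :=
  unitary_extension bounded_cod_map_aut bounded_cod_map inner_cod_map.
rewrite range_dom_map_aut range_dom_map in U1u U1r.
rewrite range_cod_map_aut range_cod_map in U2u U2r.
exists U1, U2; split=> // z x zb Ex.
have [u [Pu Qu]] := U1r _ Ex.
have wb := inv_ball _ zb.
have zE : ball_involution lambda (ball_inverse alpha z) *m omega = z.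
  by rewrite -alphaE// inv_K.
(* On the approximating sequence both characteristic functions are given by the same v k. Continuity
   passes to the limit, and single-valuedness of [limit_rel] identifies that limit with the value of
   [U2]. *)
have /choice [v uv] : forall k, exists y,
    char_fun (aut_tuple lambda omega T) z (dom_map_aut (u k)) = cod_map_aut y /\
    char_fun T (ball_inverse alpha z) (dom_map (u k)) = cod_map y.
  by move=> k; have := @char_fun_param _ (u k) wb; rewrite zE; exact.
apply: (limit_rel_fun bounded_cod_map_aut bounded_cod_map inner_cod_map).
  by apply: U2r; apply: char_fun_homo.
exists v; split.
  under eq_cvg do rewrite -(uv _).1.
  by apply: bop_cvg => //; exact: bounded_char_fun.
under eq_cvg do rewrite -(uv _).2.
by apply: bop_cvg => //; exact: bounded_char_fun.
Qed.

End Coincidence.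

(** * Multishifts *)

Section BallGeometry.
Variables (R : realType) (n : nat).
Local Notation C := R[i].
Local Notation Cn := 'rV[C]_n.
Implicit Types a b z w : Cn.

Lemma cdotC a b : cdot a b = (cdot b a)^*.
Proof.
rewrite /cdot rmorph_sum; apply: eq_bigr => i _.
by rewrite rmorphM /= conjCK mulrC.
Qed.

Lemma cdotPl (x y : C) a b w :
  cdot (x *: a - y *: b) w = x * cdot a w - y * cdot b w.
Proof.
rewrite /cdot !mulr_sumr -sumrB; apply: eq_bigr => i _.
by rewrite !mxE; ring.
Qed.

Lemma cdotPr (x y : C) a b w :
  cdot w (x *: a - y *: b) = x^* * cdot w a - y^* * cdot w b.
Proof. by rewrite cdotC cdotPl rmorphB !rmorphM /= -!(cdotC w). Qed.

Lemma cdot_unitary (omega : 'M[C]_n) a b : omega \is unitarymx ->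
  cdot (a *m omega) (b *m omega) = cdot a b.
Proof.
move=> /unitarymxP U.
have E x y : cdot x y = (x *m (y^t* )%sesqui) ord0 ord0.
  by rewrite mxE; apply: eq_bigr => i _; rewrite !mxE.
by rewrite !E trmx_mul map_mxM mulmxA -[a *m _ *m _]mulmxA U mulmx1.
Qed.

(** Transformation law of the kernel under an automorphism, cleared of denominators. z and w enter
    through equations so that a and b can be the preimages of given points. *)
Lemma kernel_ball_involution (lambda : Cn) (omega : 'M[C]_n) a b z w :
    unit_ball lambda -> omega \is unitarymx -> unit_ball a -> unit_ball b ->
    ball_involution lambda a *m omega = z -> ball_involution lambda b *m omega = w ->
  (1 - cdot z w) * ((1 - cdot a lambda) * (1 - cdot b lambda)^*) =
  s_ lambda ^+ 2 * (1 - cdot a b).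
Proof.
move=> lb U ab bb <- <-; rewrite cdot_unitary// !ball_involution_coef//.
have ua := cdot_neq1 ab lb; have ub := cdot_neq1 bb lb.
have ub' : 1 - cdot lambda b != 0 by exact: cdot_neq1.
rewrite cdotPl !cdotPr cdot_s.
rewrite !conjE.
rewrite !(s_conj lb) -(cdotC lambda b).
by field; rewrite ua ub' (s1_neq0 lb).
Qed.

End BallGeometry.

Section AnalyticOnBall.
Variables (R : realType) (n : nat).
Local Notation C := R[i].
Local Notation Cn := 'rV[C]_n.

Lemma differentiable_cdot (lambda a : (Cn : normedModType C)) (x y : C) :
  differentiable ((fun b => (x - cdot b lambda) * y) : Cn -> C^o) a.
Proof.
apply: (@differentiableM _ _ (fun b : Cn => (x - cdot b lambda : C^o)) (fun=> y)).
  apply: differentiableB; first exact: differentiable_cst.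
  rewrite (_ : (fun b => _) =
      \sum_i (fun b : Cn => b ord0 i * (lambda ord0 i)^* : C^o)).
    apply: differentiable_sum => i.
    apply: (@differentiableM _ _ (fun b : Cn => b ord0 i : C^o) (fun=> _)).
      exact: differentiable_coord.
    exact: differentiable_cst.
  by apply/funext => b; rewrite fct_sumE.
exact: differentiable_cst.
Qed.

End AnalyticOnBall.

(** * Transport of the Hardy-Arveson model *)

Section MultishiftTransport.
Variables (R : realType) (n : nat).
Local Notation C := R[i].
Local Notation Cn := 'rV[C]_n.
Variables (alpha : Cn -> Cn) (lambda : Cn) (omega : 'M[C]_n).
Hypotheses (alpha_aut : ball_automorphism alpha) (lambda_ball : unit_ball lambda)
  (omegaU : omega \is unitarymx)
  (alphaE : forall z, unit_ball z -> alpha z = ball_involution lambda z *m omega).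
Local Notation s := (s_ lambda).
Local Notation beta := (ball_inverse alpha).

Lemma ball_inverse_ball z : unit_ball z -> unit_ball (beta z).
Proof.
case: alpha_aut => -[_ _ asurj] _ _ zb.
by apply: (surjpinv_image_sub asurj); exists z.
Qed.

Lemma ball_inverseK z : unit_ball z -> alpha (beta z) = z.
Proof.
case: alpha_aut => -[_ _ asurj] _ _ zb.
by apply: (surjpK _ asurj); rewrite in_setE.
Qed.

Lemma ball_inverseKV z : unit_ball z -> beta (alpha z) = z.
Proof.
case: alpha_aut => -[_ ainj _] _ _ zb.
by apply: (pinvKV _ ainj); rewrite in_setE.
Qed.

Lemma aut_ball z : unit_ball z -> unit_ball (alpha z).
Proof. by case: alpha_aut => -[afun _ _] _ _; exact: afun. Qed.

Variables (F : hilbertType R) (ev : F -> Cn -> C).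
Hypothesis hF : hardy_arveson ev.

(* The weight is the factor by which the kernel changes under [alpha], so that
   [f |-> transported_ev f] preserves the reproducing kernel. *)
Definition transported_ev (f : F) (z : Cn) : C :=
  (1 - cdot (beta z) lambda) / s * ev f (beta z).

Lemma evP (a : C) f g z : unit_ball z -> ev (a *: f + g) z = a * ev f z + ev g z.
Proof. by case: hF => evl _ _ _; exact: evl. Qed.

Lemma evD f g z : unit_ball z -> ev (f + g) z = ev f z + ev g z.
Proof. by move=> zb; rewrite -[f in LHS]scale1r evP// mul1r. Qed.

Lemma ev0 z : unit_ball z -> ev 0 z = 0.
Proof. by move=> zb; apply: (addrI (ev 0 z)); rewrite -evD// !addr0. Qed.

Lemma evZ (a : C) f z : unit_ball z -> ev (a *: f) z = a * ev f z.
Proof. by move=> zb; rewrite -[_ *: _]addr0 evP// ev0// addr0. Qed.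

Lemma ev_sum (I : finType) (f : I -> F) z : unit_ball z ->
  ev (\sum_i f i) z = \sum_i ev (f i) z.
Proof.
by move=> zb; apply: (big_morph (ev^~ z)); [move=> ? ?; exact: evD|exact: ev0].
Qed.

Lemma ev_inj f g : (forall z, unit_ball z -> ev f z = ev g z) -> f = g.
Proof. by case: hF => _ + _ _; apply. Qed.

Lemma hardy_arveson_transported : hardy_arveson transported_ev.
Proof.
case: alpha_aut => _ _ beta_an; case: hF => _ _ evan evker; split.
- move=> a f g z zb; rewrite /transported_ev evP; last exact: ball_inverse_ball.
  by ring.
- move=> f g fg; apply: ev_inj => z zb.
  have := fg _ (aut_ball zb); rewrite /transported_ev ball_inverseKV//.
  apply: mulfI; rewrite mulf_neq0 ?cdot_neq1// invr_eq0; exact: s_neq0.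
- move=> f z zb.
  (* The transported evaluation is [h] composed with alpha^-1, whose analyticity is part of
     [ball_automorphism]. *)
  pose h (b : Cn) : C^o := (1 - cdot b lambda) / s * ev f b.
  have dh : differentiable h (beta z : (Cn : normedModType C)).
    apply: (@differentiableM _ _
      (fun b : Cn => (1 - cdot b lambda) / s : C^o) (ev f : Cn -> C^o)).
      exact: differentiable_cdot.
    by apply: evan; exact: ball_inverse_ball.
  exact: (differentiable_comp (beta_an z zb) dh).
move=> w wb; have bw := ball_inverse_ball wb.
have [k [kE kr]] := evker _ bw.
(* The new kernel vector at w is the old one at beta w times the conjugate of the weight, because
   [inner] is conjugate linear in its second argument. *)
exists (((1 - cdot (beta w) lambda) / s)^* *: k); split; last first.
  by move=> f; rewrite innerZr conjCK kr.
move=> z zb; have bz := ball_inverse_ball zb.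
rewrite /transported_ev evZ// kE// conjM conjV (s_conj lambda_ball).
have az := etrans (esym (alphaE bz)) (ball_inverseK zb).
have aw := etrans (esym (alphaE bw)) (ball_inverseK wb).
have := cdot_neq1 bz bw; have := cdot_neq1 zb wb; have := s_neq0 lambda_ball.
have := kernel_ball_involution lambda_ball omegaU bz bw az aw.
move: (1 - cdot z w) (1 - cdot (beta z) (beta w)) (_ ^*) => x y v.
move: (1 - cdot (beta z) lambda) => u xE s0 x0 y0.
have -> : u / s * (v / s / y) = (u * v) / (s ^+ 2 * y) by field; rewrite s0 y0.
rewrite -xE; have uv0 : u * v != 0.
  apply/eqP => uv; move: xE; rewrite uv mulr0 => /esym/eqP.
  by rewrite mulf_eq0 expf_eq0 (negbTE s0) (negbTE y0).
by rewrite invfM mulrCA mulfV// mulr1.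
Qed.

Variables (E K H : hilbertType R) (t : F -> E -> K) (S : 'I_n -> K -> K).
Variables (T : 'I_n -> H -> H) (W : H -> K).
Hypotheses (ht : hilbert_tensor t) (hS : standard_multishift ev t S)
  (uW : unitary_on setT setT W) (WT : forall i x, W (T i x) = S i (W x))
  (bT : forall i, bounded_operator (T i)) (cT : contractive (row_op T)).
Local Notation alphaT := (aut_tuple lambda omega T).
Local Notation G := (resolvent lambda T).

Let WP (a : C) x y : W (a *: x + y) = a *: W x + W y.
Proof. by case: uW => _ Wl _; exact: Wl. Qed.

Let bW : bounded_operator W.
Proof.
apply/bounded_operatorP; split; first exact: WP.
exists 1; split=> // x; rewrite mul1r.
rewrite -(@ler_pXn2r _ 2) ?nnegrE ?rnorm_ge0// !sqr_rnorm.
by case: uW => _ _ ->.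
Qed.

Lemma rnorm_W x : rnorm (W x) = rnorm x.
Proof.
apply/eqP; rewrite -(@eqrXn2 _ 2) ?rnorm_ge0// !sqr_rnorm.
by case: uW => _ _ ->.
Qed.

Lemma W_inj : injective W.
Proof. by case: uW => -[_ Wi _] _ _ x y; apply: Wi; rewrite in_setE. Qed.

Lemma W_inverse : exists Wi : K -> H,
  [/\ bounded_operator Wi, cancel W Wi & cancel Wi W].
Proof.
have /choice [Wi WiK] : forall y, exists x, W x = y.
  by case: uW => -[_ _ Ws] _ _ y; have [x _ xy] := Ws y I; exists x.
exists Wi; split=> //; last by move=> x; apply: W_inj; rewrite WiK.
apply/bounded_operatorP; split.
  by move=> a x y; apply: W_inj; rewrite WP !WiK.
by exists 1; split=> // x; rewrite mul1r -rnorm_W WiK.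
Qed.

Lemma tensorDl e f g : t (f + g) e = t f e + t g e.
Proof. by case: ht => tl _ _ _; have := tl e 1 f g; rewrite !scale1r. Qed.

Lemma tensorZl e a f : t (a *: f) e = a *: t f e.
Proof.
case: ht => tl _ _ _; have := tl e a f 0; rewrite addr0 => ->.
suff -> : t 0 e = 0 by rewrite addr0.
by apply: (addrI (t 0 e)); rewrite -tensorDl !addr0.
Qed.

Lemma tensor_sum e (I : finType) (f : I -> F) : t (\sum_i f i) e = \sum_i t (f i) e.
Proof.
apply: (big_morph (t^~ e)) => [? ?|]; first exact: tensorDl.
by rewrite -(scale0r 0) tensorZl scale0r.
Qed.

Lemma tensor_norm f e : rnorm (t f e) = rnorm f * rnorm e.
Proof.
apply/eqP; rewrite -(@eqrXn2 _ 2) ?mulr_ge0 ?rnorm_ge0// exprMn.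
by case: ht => _ _ ti _; rewrite (sqr_rnorm (t f e)) ti !innerxx -rmorphM.
Qed.

Lemma tensor_trivial : (forall e : E, e = 0) -> forall x : K, x = 0.
Proof.
move=> E0 x; case: ht => _ tr _ tcl.
have t0 f e : t f e = 0.
  have := tr f 1 0 0; rewrite (E0 e) !scale1r addr0 => /esym/eqP.
  by rewrite -subr_eq0 addrK => /eqP.
have : closure [set x | exists m (f : 'I_m -> F) (e : 'I_m -> E),
  x = \sum_j t (f j) (e j)] x by rewrite tcl.
move=> /closure_rnormP H0; apply/eqP; rewrite -rnorm_eq0 eq_le rnorm_ge0 andbT.
rewrite leNgt; apply/negP => /H0 [y [m [f [e ->]]]].
by rewrite big1 ?subr0 ?ltxx// => j _.
Qed.

Section Nontrivial.
Variable e0 : E.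
Hypothesis e0_neq0 : e0 != 0.

Lemma coordinate_multiplier : exists M : 'I_n -> F -> F,
  [/\ forall i f z, unit_ball z -> ev (M i f) z = z ord0 i * ev f z &
      forall i f e, S i (t f e) = t (M i f) e].
Proof.
have /choice [M HM] : forall p : 'I_n * F, exists g,
    (forall z, unit_ball z -> ev g z = z ord0 p.1 * ev p.2 z) /\
    (forall e, S p.1 (t p.2 e) = t g e).
  by move=> [i f]; case: (hS i) => _ /(_ f).
exists (fun i f => M (i, f)); split=> i f.
  by case: (HM (i, f)).
by case: (HM (i, f)).
Qed.

(** On the first tensor factor T L^* is multiplication by <a, lambda>, so G is multiplication by 1 /
    (1 - <a, lambda>). That this preserves F comes from a Neumann series on F; the norm bound it
    needs is read off from the vectors [t f e0], which requires a nonzero [e0]. *)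
Lemma resolvent_multiplier : exists GF : F -> F,
  (forall f a, unit_ball a -> ev (GF f) a = ev f a / (1 - cdot a lambda)) /\
  (forall f e x, W x = t f e -> W (G x) = t (GF f) e).
Proof.
have [M [Mev MS]] := coordinate_multiplier.
have [_ KG _] := resolventP lambda_ball bT cT.
have [r [r0 r1 _ Lcr]] := @scalar_row_bound R n H _ lambda_ball.
pose N f := \sum_i (lambda ord0 i)^* *: M i f.
have Nev f a : unit_ball a -> ev (N f) a = cdot a lambda * ev f a.
  move=> ab; rewrite ev_sum// /cdot mulr_suml; apply: eq_bigr => i _.
  by rewrite evZ// Mev//; ring.
have NW f e x : W x = t f e ->
    W (row_op T (adjoint (scalar_row lambda : dsum n H -> H) x)) = t (N f) e.
  move=> Wx; rewrite adjoint_scalar_row /row_op (bop_sum bW) tensor_sum.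
  apply: eq_bigr => i _; rewrite ffunE (bopZ (bT i)) (bopZ bW) WT Wx MS.
  by rewrite tensorZl.
have [Wi [_ WiK WKi]] := W_inverse.
have e00 : 0 < rnorm e0 by rewrite lt_neqAle eq_sym rnorm_eq0 e0_neq0 rnorm_ge0.
have Nr f : rnorm (N f) <= r * rnorm f.
  rewrite -(ler_pM2r e00) -mulrA -!tensor_norm -(NW _ _ (Wi (t f e0)))// rnorm_W.
  by rewrite (le_trans (cT _))// (le_trans (Lcr _))// -(rnorm_W (Wi _)) WKi.
have bN : bounded_operator N.
  apply/bounded_operatorP; split; last by exists r.
  move=> a f g; apply: ev_inj => z zb.
  by rewrite evP// !Nev// evP//; ring.
have [GF [_ _ GFK]] := neumann bN r1 Nr.
exists GF; split=> [f a ab|f e x Wx].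
  have u1 := cdot_neq1 ab lambda_ball.
  have := congr1 (ev^~ a) (GFK f) => /= <-.
  by rewrite -scaleN1r addrC evP// Nev//; field.
rewrite -(WKi (t (GF f) e)); congr W.
suff -> : x = Wi (t (GF f) e) -
    row_op T (adjoint (scalar_row lambda : dsum n H -> H) (Wi (t (GF f) e))).
  exact: KG.
apply: W_inj; rewrite (bopD bW) (bopN bW) WKi (NW (GF f) e)// Wx.
by rewrite -{1}(GFK f) tensorDl -scaleN1r tensorZl scaleN1r.
Qed.

(** The witness copies [involution_rowE] with multiplications for T and G. By [ball_involution_coef]
    its value at a is the j-th coordinate of alpha(a) times that of f, and a = beta z makes this
    coordinate z_j. *)
Lemma aut_tuple_multiplier j f : exists g : F,
  (forall z, unit_ball z ->
    transported_ev g z = z ord0 j * transported_ev f z) /\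
  (forall e x, W x = t f e -> W (alphaT j x) = t g e).
Proof.
have [M [Mev MS]] := coordinate_multiplier.
have [GF [GFev GW]] := resolvent_multiplier.
pose mu := (lambda *m omega) ord0 j; pose c := (1 + s)^-1.
pose Mf := \sum_i omega i j *: M i f.
exists ((c * mu) *: f - s *: GF Mf + (s * c * mu) *: GF f); split.
  move=> z zb; rewrite /transported_ev; have ab := ball_inverse_ball zb.
  rewrite -[in z ord0 j](ball_inverseK zb) alphaE//.
  move: (beta z) ab => a ab; have u1 := cdot_neq1 ab lambda_ball.
  have Mfa : ev Mf a = (a *m omega) ord0 j * ev f a.
    rewrite ev_sum// mxE mulr_suml; apply: eq_bigr => i _.
    by rewrite evZ// Mev//; ring.
  rewrite ball_involution_coef// mulmxBl -!scalemxAl !mxE -/mu.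
  rewrite -[\sum_k _](_ : (lambda *m omega) ord0 j = _); last by rewrite mxE.
  rewrite -[\sum_k a _ _ * _](_ : (a *m omega) ord0 j = _); last by rewrite mxE.
  rewrite -/mu !evD// evZ// -scaleNr !evZ// !GFev// Mfa /c.
  by field; rewrite (s_neq0 lambda_ball) (s1_neq0 lambda_ball) u1.
move=> e x Wx; rewrite /aut_tuple /row_entry /=.
set h := tensor_mx _ _.
have hE i : h i = omega i j *: x.
  rewrite tensor_mxE (bigD1 j)//= ffunE eqxx big1 ?addr0// => k kj.
  by rewrite ffunE (negbTE kj) scaler0.
rewrite (involution_rowE lambda_ball bT cT).
have Lh : scalar_row lambda h = mu *: x.
  rewrite /scalar_row /row_op /mu mxE scaler_suml; apply: eq_bigr => i _.
  by rewrite hE scalerA.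
have WTh : W (row_op T h) = t Mf e.
  rewrite /row_op (bop_sum bW) tensor_sum; apply: eq_bigr => i _.
  by rewrite hE (bopZ (bT i)) (bopZ bW) WT Wx MS tensorZl.
have [bG _ _] := resolventP lambda_ball bT cT.
rewrite Lh (bopZ bG) !(bopD bW, bopN bW, bopZ bW) (GW _ _ _ Wx) (GW _ _ _ WTh) Wx.
by rewrite !tensorDl -!scaleNr !tensorZl !scalerA.
Qed.

End Nontrivial.

Lemma multishift_transport : multishift E alphaT.
Proof.
(* A zero E offers no nonzero [e0]; then K = 0 and the given model serves for alpha(T) too. *)
have [E0|] := pselect (forall e : E, e = 0).
  exists F, K, ev, t, S; split=> //; exists W; split=> // i x.
  by rewrite (tensor_trivial E0 (W _)) (tensor_trivial E0 (S i _)).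
move=> /existsNP [e0 /eqP e00].
have [Wi [bWi WiK WKi]] := W_inverse.
(* The new shift is alpha(T) carried over by W; it multiplies by z_i with respect to the transported
   evaluations. *)
exists F, K, transported_ev, t, (fun i v => W (alphaT i (Wi v))); split=> //.
- exact: hardy_arveson_transported.
- move=> i; split.
    apply: bounded_comp => //; apply: bounded_comp => //.
    exact: bounded_aut_tuple.
  move=> f; have [g [gev gt]] := aut_tuple_multiplier e00 i f.
  by exists g; split=> // e; apply: gt; rewrite WKi.
by exists W; split=> // i x; rewrite WiK.
Qed.

End MultishiftTransport.

Theorem theorem6p3 (R : realType) (n : nat) (n_ge1 : (1 <= n)%N)
    (alpha : 'rV[R[i]]_n -> 'rV[R[i]]_n) (alpha_aut : ball_automorphism alpha)
    (lambda : 'rV[R[i]]_n) (lambda_ball : unit_ball lambda)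
    (omega : 'M[R[i]]_n) (omega_unitary : omega \is unitarymx)
    (alphaE : forall z, unit_ball z ->
       alpha z = ball_involution lambda z *m omega)
    (H : hilbertType R) (T : 'I_n -> H -> H)
    (T_mc : commuting_multicontraction T) :
  let alphaT := aut_tuple lambda omega T in
  [/\ (cnc alphaT <-> cnc T)
      /\ (class_C1 alphaT <-> class_C1 T)
      /\ (class_C0 alphaT <-> class_C0 T),
      coincide
        (defect_space (row_op alphaT)) (defect_space (adjoint (row_op alphaT)))
        (char_fun alphaT)
        (defect_space (row_op T)) (defect_space (adjoint (row_op T)))
        (fun z => char_fun T (ball_inverse alpha z)) &
      forall E : hilbertType R, multishift E T -> multishift E alphaT].
Proof.
case: T_mc => bT _ /(row_contractive bT) cT alphaT.
split.
- have AE := A_infty_aut_tuple lambda_ball omega_unitary bT cT.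
  by rewrite /cnc /class_C1 /class_C0 /alphaT AE.
- by apply: coincide_aut_tuple => //; case: alpha_aut.
- move=> E [F [K [ev [t [S [hF ht hS [W [uW WT]]]]]]]].
  exact: (multishift_transport alpha_aut lambda_ball omega_unitary alphaE hF ht hS
    uW WT bT cT).
Qed.
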